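(* If an $n$-dimensional Bieberbach manifold has holonomy group isomorphic to $\mathbb{Z}_2$, then it is a geodesic boundary, i.e. it is the totally geodesic boundary of a compact flat Riemannian manifold.
   Context: All manifolds are assumed connected. A Bieberbach group in dimension $n$ is a discrete, co-compact group $\Gamma$ of affine isometries of $\mathbb{R}^n$ acting without fixed points; a Bieberbach manifold is the quotient $\mathbb{R}^n/\Gamma$ with the induced flat metric. The translations in $\Gamma$ form a normal subgroup $\Lambda$ of finite index, which is a lattice of $\mathbb{R}^n$; the finite group $G=\Gamma/\Lambda$ is the holonomy group of $\mathbb{R}^n/\Gamma$. A Bieberbach manifold $N$ of dimension $n$ is the totally geodesic boundary of a compact flat manifold if there is a compact flat Riemannian manifold $M$ of dimension $n+1$ with totally geodesic boundary $\partial M$ isometric to $N$. *)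

(* Defs.v *)
From HB Require Import structures.
From mathcomp Require Import all_boot all_order all_algebra.
From mathcomp Require Import all_classical all_reals all_analysis.
Set Implicit Arguments.
Unset Strict Implicit.
Unset Printing Implicit Defensive.
Import Order.TTheory GRing.Theory Num.Theory.
Import numFieldNormedType.Exports.
Local Open Scope classical_set_scope.
Local Open Scope ring_scope.

(* Points and tangent vectors are row vectors, so a linear map acts by
   right multiplication by a matrix.  The domains [D] below are meant to be
   relatively open subsets of R^n or of a half-space. *)

Fixpoint class_Ck (R : realType) (n : nat) (V : normedModType R) (k : nat)
    (U : set 'rV[R]_n) (F : 'rV[R]_n -> V) : Prop :=
  (forall x, U x -> {for x, continuous F}) /\
  if k is k'.+1 then
    forall i : 'I_n,
      (forall x, U x -> derivable F x (delta_mx 0 i)) /\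
      class_Ck k' U (fun x => 'D_(delta_mx 0 i) F x)
  else True.

(* [D] need not be open: smoothness at a boundary point of a half-space means
   the existence of a smooth extension to a neighbourhood in R^n. *)
Definition smooth_on (R : realType) (n : nat) (V : normedModType R)
    (D : set 'rV[R]_n) (F : 'rV[R]_n -> V) : Prop :=
  forall x, D x -> exists U : set 'rV[R]_n, exists G : 'rV[R]_n -> V,
    [/\ open U, U x, forall k, class_Ck k U G
      & forall y, U y -> D y -> F y = G y].

(* The i-th partial derivative at [x] of a function on [D]: the increments are
   restricted to those that stay in [D], so the derivative is one-sided in the
   transverse direction at a boundary point of a half-space. *)
Definition partial (R : realType) (n : nat) (V : normedModType R)
    (D : set 'rV[R]_n) (i : 'I_n) (F : 'rV[R]_n -> V) (x : 'rV[R]_n) : V :=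
  lim ((h^-1 *: (F (x + h *: delta_mx 0 i) - F x))
        @[h --> within [set h : R | D (x + h *: delta_mx 0 i)] (0 : R)^']).

Definition jacobian (R : realType) (n m : nat) (D : set 'rV[R]_n)
    (F : 'rV[R]_n -> 'rV[R]_m) (x : 'rV[R]_n) : 'M[R]_(n, m) :=
  \matrix_(i, j) partial D i F x 0 j.

(* Christoffel symbols of the second kind: [christoffel D G k a b x] is the
   k-th component at [x] of the covariant derivative of the b-th coordinate
   field in the direction of the a-th one, for the metric tensor [G]. *)
Definition christoffel (R : realType) (n : nat) (D : set 'rV[R]_n)
    (G : 'rV[R]_n -> 'M[R]_n) (k a b : 'I_n) (x : 'rV[R]_n) : R :=
  2^-1 * \sum_(l < n) invmx (G x) k l *
    (partial D a (fun y => G y b l : R^o) x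
     + partial D b (fun y => G y a l : R^o) x
     - partial D l (fun y => G y a b : R^o) x).

(* The component R^l_{kij} of the Riemann curvature tensor, with the convention
   R(e_i, e_j) e_k = \sum_l R^l_{kij} e_l. *)
Definition riemann_curvature (R : realType) (n : nat) (D : set 'rV[R]_n)
    (G : 'rV[R]_n -> 'M[R]_n) (l k i j : 'I_n) (x : 'rV[R]_n) : R :=
  partial D i (christoffel D G l j k : _ -> R^o) x
  - partial D j (christoffel D G l i k : _ -> R^o) x
  + \sum_(m < n)
      (christoffel D G l i m x * christoffel D G m j k x
       - christoffel D G l j m x * christoffel D G m i k x).

(* Raw data of an atlas together with the matrix of a metric tensor in each of
   its charts; the axioms are collected in [is_riemannian_manifold].  The
   functions [coord i] and [metric i] are only relevant on [dom i]. *)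
Record riemannian_data (R : realType) (n : nat) := RiemannianData {
  carrier :> topologicalType;
  chart : Type;
  dom : chart -> set carrier;
  coord : chart -> carrier -> 'rV[R]_n;
  metric : chart -> carrier -> 'M[R]_n
}.

Section RiemannianManifolds.
Variable R : realType.
Implicit Types n : nat.

(* The expression of [F] in the chart [i], that is F \o (coord i)^-1; it is 0
   outside of coord i @` dom i. *)
Definition in_chart n (M : riemannian_data R n) (V : normedModType R)
    (i : chart M) (F : M -> V) (x : 'rV[R]_n) : V :=
  xget 0 (F @` [set p | dom i p /\ coord i p = x]).

Definition smooth_map n m (M : riemannian_data R n) (N : riemannian_data R m)
    (f : M -> N) : Prop :=
  continuous f /\
  forall (i : chart M) (j : chart N),
    smooth_on (coord i @` (dom i `&` f @^-1` dom j))
              (in_chart i (fun p => coord j (f p))).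

(* The differential of [f] at [p], in the charts [i] and [j]. *)
Definition differential n m (M : riemannian_data R n)
    (N : riemannian_data R m) (f : M -> N) (i : chart M) (j : chart N)
    (p : M) : 'M[R]_(n, m) :=
  jacobian (coord i @` (dom i `&` f @^-1` dom j))
           (in_chart i (fun q => coord j (f q))) (coord i p).

Definition preserves_metric n m (M : riemannian_data R n)
    (N : riemannian_data R m) (f : M -> N) : Prop :=
  forall (i : chart M) (j : chart N) (p : M), dom i p -> dom j (f p) ->
    metric i p =
      differential f i j p *m metric j (f p) *m (differential f i j p)^T.

Definition isometric n (M N : riemannian_data R n) : Prop :=
  exists (f : M -> N) (g : N -> M),
    [/\ cancel f g, cancel g f, smooth_map f, smooth_map g
      & preserves_metric f].

(* [X] is the local model: the whole space for manifolds without boundary, the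
   half-space for manifolds with boundary.  The identity map being smooth and
   metric-preserving expresses the smoothness of the transition maps and the
   transformation law of the metric tensor. *)
Record is_riemannian_manifold n (X : set 'rV[R]_n)
    (M : riemannian_data R n) : Prop := IsRiemannianManifold {
  rm_hausdorff : hausdorff_space M;
  rm_second_countable : @second_countable M;
  rm_cover : forall p : M, exists i : chart M, dom i p;
  rm_dom_open : forall i : chart M, open (dom i);
  rm_coord_inj : forall i : chart M, set_inj (dom i) (coord i);
  rm_coord_homeo : forall (i : chart M) (U : set M), U `<=` dom i ->
    open U <-> exists2 W, open W & coord i @` U = X `&` W;
  rm_transition : smooth_map (idfun : M -> M);
  rm_metric_sym : forall (i : chart M) (p : M), dom i p ->
    (metric i p)^T = metric i p;
  rm_metric_pos : forall (i : chart M) (p : M), dom i p ->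
    forall v : 'rV[R]_n, v != 0 -> 0 < (v *m metric i p *m v^T) 0 0;
  rm_metric_smooth : forall i : chart M,
    smooth_on (coord i @` dom i) (in_chart i (metric i));
  rm_metric_compat : preserves_metric (idfun : M -> M)
}.

Definition flat n (M : riemannian_data R n) : Prop :=
  forall (i : chart M) (p : M), dom i p -> forall l k a b : 'I_n,
    riemann_curvature (coord i @` dom i) (in_chart i (metric i)) l k a b
      (coord i p) = 0.

Definition half_space n : set 'rV[R]_n.+1 := [set x | 0 <= x 0 ord0].

Definition boundary n (M : riemannian_data R n.+1) : set M :=
  [set p | exists2 i : chart M, dom i p & coord i p 0 ord0 = 0].
Arguments boundary {n} M.

(* The boundary, with the subspace topology, the restricted charts without
   their first coordinate, and the induced metric. *)
Definition boundary_manifold n (M : riemannian_data R n.+1) :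
    riemannian_data R n :=
  @RiemannianData R n
    (set_type (boundary M))
    (chart M)
    (fun i => set_val @^-1` dom i)
    (fun i p => col' ord0 (coord i (set_val p)))
    (fun i p => row' ord0 (col' ord0 (metric i (set_val p)))).

(* The inward unit normal at a boundary point, in the chart [i]. *)
Definition unit_normal n (M : riemannian_data R n.+1) (i : chart M) (p : M) :
    'rV[R]_n.+1 :=
  (Num.sqrt (invmx (metric i p) ord0 ord0))^-1 *:
    row ord0 (invmx (metric i p)).

(* The covariant derivative of the b-th coordinate field along the a-th one. *)
Definition covariant_derivative n (M : riemannian_data R n) (i : chart M)
    (p : M) (a b : 'I_n) : 'rV[R]_n :=
  \row_k christoffel (coord i @` dom i) (in_chart i (metric i)) k a b
           (coord i p).

(* The second fundamental form, on the coordinate fields with indices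
   [lift ord0 a], which span the tangent space of the boundary. *)
Definition second_fundamental_form n (M : riemannian_data R n.+1)
    (i : chart M) (p : M) (a b : 'I_n) : R :=
  (covariant_derivative i p (lift ord0 a) (lift ord0 b) *m metric i p
     *m (unit_normal i p)^T) 0 0.

Definition totally_geodesic_boundary n (M : riemannian_data R n.+1) : Prop :=
  forall (i : chart M) (p : M), dom i p -> coord i p 0 ord0 = 0 ->
    forall a b : 'I_n, second_fundamental_form i p a b = 0.

Definition geodesic_boundary n (N : riemannian_data R n) : Prop :=
  exists M : riemannian_data R n.+1,
    [/\ is_riemannian_manifold (@half_space n) M, connected [set: M],
        compact [set: M], flat M &
        totally_geodesic_boundary M /\ isometric (boundary_manifold M) N].

End RiemannianManifolds.

Section Bieberbach.
Variables (R : realType) (n : nat).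

(* The pair (A, b) stands for the affine map x |-> x A + b. *)
Definition affine_map : Type := ('M[R]_n * 'rV[R]_n)%type.
Implicit Types (g h : affine_map) (Gamma : set affine_map).

Definition affine_act g (x : 'rV[R]_n) : 'rV[R]_n := x *m g.1 + g.2.

Definition affine_id : affine_map := (1%:M, 0).

(* First [h], then [g]. *)
Definition affine_comp g h : affine_map := (h.1 *m g.1, h.2 *m g.1 + g.2).

Definition is_isometry g : Prop := g.1 *m g.1^T = 1%:M.

Record is_isometry_group Gamma : Prop := IsIsometryGroup {
  ig_isometry : forall g, Gamma g -> is_isometry g;
  ig_id : Gamma affine_id;
  ig_comp : forall g h, Gamma g -> Gamma h -> Gamma (affine_comp g h);
  ig_inv : forall g, Gamma g ->
    exists2 h, Gamma h & affine_comp h g = affine_id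
}.

Definition orbit Gamma (x : 'rV[R]_n) : set 'rV[R]_n :=
  [set affine_act g x | g in Gamma].

Definition same_orbit Gamma : rel 'rV[R]_n :=
  fun x y => `[< orbit Gamma x = orbit Gamma y >].

Lemma same_orbit_refl Gamma : reflexive (same_orbit Gamma).
Proof. by move=> x; apply/asboolP. Qed.

Lemma same_orbit_sym Gamma : symmetric (same_orbit Gamma).
Proof. by move=> x y; apply/asboolP/asboolP. Qed.

Lemma same_orbit_trans Gamma : transitive (same_orbit Gamma).
Proof. by move=> y x z /asboolP xy /asboolP yz; apply/asboolP; rewrite xy. Qed.

Canonical same_orbit_equiv Gamma :=
  EquivRel (same_orbit Gamma) (@same_orbit_refl Gamma)
    (@same_orbit_sym Gamma) (@same_orbit_trans Gamma).

Definition orbit_space Gamma : topologicalType :=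
  quotient_topology {eq_quot (same_orbit_equiv Gamma)}%qT.

Definition orbit_proj Gamma (x : 'rV[R]_n) : orbit_space Gamma :=
  (\pi_({eq_quot (same_orbit_equiv Gamma)}) x)%qT.

Record is_bieberbach Gamma : Prop := IsBieberbach {
  bb_group : is_isometry_group Gamma;
  bb_discrete : isolated Gamma = Gamma;
  bb_cocompact : compact [set: orbit_space Gamma];
  bb_free : forall g x, Gamma g -> affine_act g x = x -> g = affine_id
}.

(* R^n/Gamma: the charts are the inverses of the restrictions of the
   projection to the open sets on which it is injective, and the induced metric
   is the standard one in these charts. *)
Definition bieberbach_manifold Gamma : riemannian_data R n :=
  @RiemannianData R n (orbit_space Gamma)
    {U : set 'rV[R]_n | open U /\ set_inj U (@orbit_proj Gamma)}
    (fun U => @orbit_proj Gamma @` sval U)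
    (fun U q => xget 0 (sval U `&` @orbit_proj Gamma @^-1` [set q]))
    (fun _ _ => 1%:M).

Definition translations Gamma : set affine_map :=
  [set g | Gamma g /\ g.1 = 1%:M].

Definition translation_coset Gamma g : set affine_map :=
  [set affine_comp g t | t in translations Gamma].

(* The elements of the holonomy group Gamma/Lambda. *)
Definition holonomy Gamma : set (set affine_map) :=
  [set translation_coset Gamma g | g in Gamma].

(* An isomorphism from Gamma/Lambda onto the cyclic group of order 2. *)
Definition holonomy_isog_Z2 Gamma : Prop :=
  exists f : set affine_map -> 'Z_2,
    set_bij (holonomy Gamma) [set: 'Z_2] f /\
    forall g h, Gamma g -> Gamma h ->
      f (translation_coset Gamma (affine_comp g h)) =
      f (translation_coset Gamma g) + f (translation_coset Gamma h).

End Bieberbach.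

(* Main.v *)
Require Import Defs.
From mathcomp Require Import all_boot all_order all_algebra.
From mathcomp Require Import all_classical all_reals all_analysis.
From mathcomp Require Import zify ring lra.

(* Let A be the nontrivial holonomy.  By cocompactness some translation x of
   Gamma is moved by A, so x - xA is a nonzero translation of Gamma in the
   (-1)-eigenspace of A; halving it as often as possible gives t with tA = -t,
   2t in Gamma and t not in Gamma.  The translation by t then normalises Gamma,
   squares into Gamma, and the nontrivial coset has no fixed point (apply 1 + A
   to a fixed point equation), so it induces a free isometric involution s of
   N = R^n/Gamma.  The wanted manifold is (N * [0,1]) / (p,u) ~ (s p, 1 - u),
   whose boundary is the image of N * {0}.  It is realised as the quotient of
   R * R^n by a discrete group that also contains the reflections
   u |-> 2k - u, with local inverses of the projection, restricted to u >= 0,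
   as charts; in these charts the metric is constant and the transition maps
   are locally affine isometries. *)

Set Implicit Arguments.
Unset Strict Implicit.
Unset Printing Implicit Defensive.
Import Order.TTheory GRing.Theory Num.Theory.
Import numFieldNormedType.Exports.
Local Open Scope classical_set_scope.
Local Open Scope ring_scope.

(** * Orbit spaces of isometry groups *)

Section OrbitSpaces.
Variables (R : realType) (n : nat).
Implicit Types (x y z : 'rV[R]_n) (g h : affine_map R n).

(** * Affine maps and estimates in the maximum norm *)

Lemma affine_actM g h x :
  affine_act (affine_comp g h) x = affine_act g (affine_act h x).
Proof. by rewrite /affine_act /= mulmxDl addrA mulmxA. Qed.

Lemma affine_act_id x : affine_act (affine_id R n) x = x.
Proof. by rewrite /affine_act /= mulmx1 addr0. Qed.

Lemma affine_actB g x y : affine_act g x - affine_act g y = (x - y) *m g.1.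
Proof. by rewrite /affine_act opprD addrACA subrr addr0 mulmxBl. Qed.

Lemma mx_norm_le m p (B : 'M[R]_(m, p)) (c : R) :
  0 <= c -> (forall i j, `|B i j| <= c) -> `|B| <= c.
Proof.
move=> c0 Bc; rewrite /Num.norm /= mx_normrE.
by apply/bigmax_leP; split => // -[i j] _ /=.
Qed.

Lemma coef_le_mx_norm m p (B : 'M[R]_(m, p)) i j : `|B i j| <= `|B|.
Proof.
rewrite [leRHS]/Num.norm /= mx_normrE.
exact: (@le_bigmax_cond _ _ _ _ (i, j) xpredT (fun k => `|B k.1 k.2|)).
Qed.

Lemma mulmx_norm_le p x (B : 'M[R]_(n, p)) : `|x *m B| <= n%:R * `|B| * `|x|.
Proof.
apply: mx_norm_le => [|i j]; first by rewrite !mulr_ge0.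
rewrite mxE (le_trans (ler_norm_sum _ _ _)) //.
apply: (le_trans (ler_sum _ (G := fun _ => `|B| * `|x|) _)) => [k _|].
  by rewrite normrM mulrC ler_pM //; exact: coef_le_mx_norm.
by rewrite sumr_const card_ord -mulrA mulr_natl.
Qed.

(** The diagonal of [B *m B^T] makes every row a unit vector, so each entry is at most 1 in absolute
    value, and the norm is the largest entry. *)
Lemma orthogonal_norm_le (B : 'M[R]_n) : B *m B^T = 1%:M -> `|B| <= 1.
Proof.
move=> BBT; apply: mx_norm_le => // i j.
have /matrixP/(_ i i) := BBT; rewrite !mxE eqxx mulr1n (bigD1 j) //= mxE => s1.
rewrite -(@ler_pXn2r _ 2) ?nnegrE ?ler01 ?normr_ge0 // expr1n.
rewrite real_normK ?num_real // -s1 expr2 lerDl sumr_ge0 // => k _.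
by rewrite mxE -expr2 sqr_ge0.
Qed.

(** The norm is the maximum norm, which a Euclidean isometry need not preserve; a Lipschitz constant
    common to the whole group is what the separation arguments use. *)
Lemma isometry_lipschitz g x y : is_isometry g ->
  `|affine_act g x - affine_act g y| <= n%:R * `|x - y|.
Proof.
move=> gi; rewrite affine_actB (le_trans (mulmx_norm_le _ _)) //.
by rewrite ler_wpM2r // ler_piMr // orthogonal_norm_le.
Qed.

Lemma lipschitz_continuous (V W : normedModType R) (f : V -> W) (c : R) :
  0 < c -> (forall u v, `|f u - f v| <= c * `|u - v|) -> continuous f.
Proof.
move=> c0 fc u; apply/cvgrPdist_le => /= e e0.
near=> v; rewrite (le_trans (fc _ _)) // -ler_pdivlMl //.
near: v; apply/nbhs_normP; exists (c^-1 * e) => /=.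
  by rewrite mulr_gt0 ?invr_gt0.
by move=> v /= /ltW.
Unshelve. all: by end_near. Qed.

Lemma affine_act_continuous g : continuous (affine_act g).
Proof.
apply: (@lipschitz_continuous _ _ _ (n%:R * `|g.1| + 1)) => [|x y].
  by rewrite ltr_wpDl // mulr_ge0.
rewrite affine_actB (le_trans (mulmx_norm_le _ _)) //.
by rewrite ler_wpM2r // lerDl.
Qed.

(** * Topology of the orbit space *)

Section Quotient.
Variable Gamma : set (affine_map R n).
Hypothesis hGamma : is_isometry_group Gamma.
Local Notation pi := (@orbit_proj R n Gamma).

Lemma isometry_group_inv g : Gamma g -> exists h,
  [/\ Gamma h, cancel (affine_act g) (affine_act h)
    & cancel (affine_act h) (affine_act g)].
Proof.
move=> gG; have [h hG hg] := ig_inv hGamma gG.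
have [k kG kh] := ig_inv hGamma hG.
have gK : cancel (affine_act g) (affine_act h).
  by move=> x; rewrite -affine_actM hg affine_act_id.
have hK : cancel (affine_act h) (affine_act k).
  by move=> x; rewrite -affine_actM kh affine_act_id.
exists h; split => // x.
by rewrite -{2}(hK x) -{2}(gK (affine_act h x)) hK.
Qed.

(** The quotient is taken by equality of orbits; the group axioms turn this into a single group
    element relating the two points. *)
Lemma orbit_projP x y :
  pi x = pi y <-> exists2 g, Gamma g & affine_act g x = y.
Proof.
have pixy z : pi x = pi z <-> same_orbit Gamma x z.
  by split => [/eqquotP //|xy]; exact/eqquotP.
split=> [/pixy/asboolP xy|[g gG <-]].
  have : Defs.orbit Gamma x y.
    rewrite xy; exists (affine_id R n); [exact: (ig_id hGamma)|].
    exact: affine_act_id.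
  by case=> g gG gx; exists g.
apply/pixy/asboolP; rewrite eqEsubset; split=> _ [h hG <-].
  have [k [kG gK _]] := isometry_group_inv gG.
  exists (affine_comp h k); first exact: (ig_comp hGamma).
  by rewrite affine_actM gK.
exists (affine_comp h g); first exact: (ig_comp hGamma).
by rewrite affine_actM.
Qed.

Lemma orbit_proj_continuous : continuous pi.
Proof. exact: pi_continuous. Qed.

Lemma orbit_proj_surj q : exists x, pi x = q.
Proof. by exists (repr q); rewrite /orbit_proj reprK. Qed.

Lemma xget_orbit_proj U x :
  set_inj U pi -> U x -> xget 0 (U `&` pi @^-1` [set pi x]) = x.
Proof.
move=> Uinj Ux; case: xgetP => [z _ [Uz /= zx]|/(_ x)]; last by case.
by apply: Uinj => //; exact/mem_set.
Qed.

(** The saturation of [W] is the union of its preimages under the elements of [Gamma], which are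
    continuous. *)
Lemma open_orbit_proj (W : set 'rV[R]_n) : open W -> open (pi @` W).
Proof.
move=> oW; rewrite /open /= /quotient_open.
rewrite (_ : _ @^-1` _ = \bigcup_(g in Gamma) (affine_act g @^-1` W)).
  apply: bigcup_open => g _; apply: open_comp => // x _.
  exact: affine_act_continuous.
rewrite eqEsubset; split=> x.
  move=> [y Wy /esym/orbit_projP [g gG gx]].
  by exists g => //=; rewrite gx.
move=> [g gG Wx]; exists (affine_act g x) => //.
by apply/esym/orbit_projP; exists g.
Qed.

Lemma nbhs_orbit_proj x (W : set 'rV[R]_n) :
  nbhs x W -> nbhs (pi x) (pi @` W).
Proof.
move=> /nbhs_interior Wx.
have /filterS : pi @` W° `<=` pi @` W.
  by apply: image_subset; exact: interior_subset.
apply; apply: (@open_nbhs_nbhs (orbit_space Gamma)); split.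
  by apply: open_orbit_proj; exact: open_interior.
by exists x => //; exact: nbhs_singleton.
Qed.

(** Take balls of radius r = d / (n + 1) about [x] and [y]. If [g] sends a point of the first into
    the second, then, [g] being n-Lipschitz, it sends [x] within n r + r = d of [y], hence onto
    [y]. *)
Lemma orbit_space_hausdorff :
  (forall x y, exists2 d : R, 0 < d &
    forall g, Gamma g -> `|affine_act g x - y| < d -> affine_act g x = y) ->
  hausdorff_space (orbit_space Gamma).
Proof.
move=> disc; rewrite open_hausdorff => p q.
have [x <-] := orbit_proj_surj p; have [y <-] := orbit_proj_surj q => xy.
have [d d0 xyd] := disc x y.
have e0 : 0 < d / (n%:R + 1) by rewrite divr_gt0 // ltr_wpDl.
pose B z := ball z (d / (n%:R + 1)).
exists (pi @` B x, pi @` B y) => /=.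
  by split; apply/mem_set; [exists x|exists y] => //; exact: ballxx.
split; [apply: open_orbit_proj; exact: ball_open..|].
apply/eqP; rewrite -subset0 => _ [[x' xx' <-] [y' yy' /esym/orbit_projP]].
move=> [g gG gx'].
have /negP := xy; apply; apply/eqP/orbit_projP; exists g => //.
apply: xyd => //; rewrite -(subrKA y') -gx'.
move: xx' yy'; rewrite /B -ball_normE /= => xx' yy'.
rewrite (le_lt_trans (ler_normD _ _)) //.
have -> : d = n%:R * (d / (n%:R + 1)) + d / (n%:R + 1).
  by field; rewrite gt_eqF // ltr_wpDl.
rewrite ler_ltD //; last by rewrite gx' distrC.
rewrite (le_trans (isometry_lipschitz _ _ (ig_isometry hGamma gG))) //.
by rewrite ler_wpM2l // ltW.
Qed.

(** The images of the lines through the origin cover the quotient and all contain [pi 0]. *)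
Lemma orbit_space_connected : connected [set: orbit_space Gamma].
Proof.
have -> : [set: orbit_space Gamma] =
    \bigcup_x ((fun s : R => pi (s *: x)) @` setT).
  rewrite eqEsubset; split=> // q _.
  have [x <-] := orbit_proj_surj q.
  by exists x => //; exists 1 => //; rewrite scale1r.
apply: bigcup_connected.
  by exists (pi 0) => x _; exists 0 => //; rewrite scale0r.
move=> x _; apply: connected_continuous_connected.
  by apply/connected_intervalP => // ? ?.
apply: continuous_subspaceT => s.
apply: continuous_comp; last exact: orbit_proj_continuous.
exact: scalel_continuous.
Qed.

Lemma compact_orbit_spaceP : compact [set: orbit_space Gamma] <->
  exists M : R, forall x, exists2 g, Gamma g & `|affine_act g x| <= M.
Proof.
split=> [/compact_near_coveringP/(_ nat \oo)|[M bM]].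
  (* The near-covering form of compactness, along the filter of large integers, turns the bounds on
     single orbits into one bound [N] for all of them. *)
  pose P (i : nat) (q : orbit_space Gamma) :=
    exists2 x, pi x = q & `|x| <= i%:R.
  move=> /(_ P _ _)[q _|N _ NP].
    have [x <-] := orbit_proj_surj q.
    exists ((pi @` ball x 1), [set i | `|x| + 1 <= i%:R]) => /=.
      split.
        by apply: nbhs_orbit_proj; exact: nbhsx_ballx.
      exists (Num.bound (`|x| + 1)) => // i /= Ni.
      apply/ltW/(lt_le_trans (archi_boundP _)); first by rewrite addr_ge0.
      by rewrite ler_nat.
    move=> [_ i] [/= [y xy <-] Ni]; exists y => //.
    apply: le_trans Ni; rewrite -lerBlDl (le_trans (lerB_dist _ _)) //.
    by rewrite -ball_normE /= distrC in xy; exact: ltW.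
  exists N%:R => x.
  have [y /esym/orbit_projP [g gG <-] yN] := NP N (leqnn N) (pi x) I.
  by exists g.
pose K : set 'rV[R]_n := [set x | `|x| <= M].
have -> : [set: orbit_space Gamma] = pi @` K.
  rewrite eqEsubset; split=> // q _; have [x <-] := orbit_proj_surj q.
  have [g gG gx] := bM x; exists (affine_act g x) => //.
  by apply/esym/orbit_projP; exists g.
apply: continuous_compact.
  apply: continuous_subspaceT; exact: orbit_proj_continuous.
apply: bounded_closed_compact.
  exists M; split=> [|N MN x /= Kx]; first exact: num_real.
  exact: le_trans Kx (ltW MN).
rewrite (_ : K = (fun x => `|x|) @^-1` [set r : R | r <= M]) //.
apply: closed_comp => [x _|]; [exact: norm_continuous|exact: closed_le].
Qed.

Lemma rat_vector_dense x (e : R) : 0 < e ->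
  exists c : 'rV[rat]_n, `|map_mx ratr c - x| < e.
Proof.
move=> e0.
have e20 : 0 < e / 2 by rewrite divr_gt0.
have xc j : exists c : rat, `|ratr c - x 0 j| <= e / 2.
  have [|c] := @rat_in_itvoo R (x 0 j) (x 0 j + e / 2).
    by rewrite ltrDl.
  rewrite in_itv /= => /andP[c1 c2].
  by exists c; rewrite ler_norml; apply/andP; split; lra.
exists (\row_j xget 0 [set c : rat | `|ratr c - x 0 j| <= e / 2]).
apply: (@le_lt_trans _ _ (e / 2)); last first.
  by rewrite ltr_pdivrMr // ltr_pMr // ltr1n.
apply: mx_norm_le => [|i j]; first exact: ltW.
rewrite (ord1 i) !mxE; case: xgetP => [c _ //|/= nc].
by have [c /nc] := xc j.
Qed.

(** The projection is open and continuous, so the images of the balls with rational centre and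
    radius 1 / (k + 1) form a countable base. *)
Lemma orbit_space_second_countable : @second_countable (orbit_space Gamma).
Proof.
pose B (ci : 'rV[rat]_n * nat) : set (orbit_space Gamma) :=
  pi @` ball (map_mx ratr ci.1 : 'rV[R]_n) ci.2.+1%:R^-1.
exists (range B).
  exact: (sub_countable (card_image_le _ _)).
split=> [_ [ci _ <-]|q V]; first by apply: open_orbit_proj; exact: ball_open.
have [x <-] := orbit_proj_surj q.
move=> /(@orbit_proj_continuous x) /nbhs_ballP [e /= e0 xeV].
have [k ke] : exists k, k.+1%:R^-1 < e / 2 :> R.
  have [k _ /(_ k (leqnn k)) /=] :=
    near_infty_natSinv_lt (PosNum (divr_gt0 e0 (ltr0n R 2))).
  by exists k.
have [c xc] := @rat_vector_dense x k.+1%:R^-1 ltac:(by rewrite invr_gt0).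
exists (B (c, k)).
  split; first by exists (c, k).
  by exists x => //=; rewrite -ball_normE.
move=> _ [y cy <-]; apply: xeV; rewrite -ball_normE /=.
rewrite -ball_normE /= in cy.
rewrite -(subrKA (map_mx ratr c)) (le_lt_trans (ler_normD _ _)) //.
by rewrite distrC in xc; rewrite (splitr e) ltrD ?(lt_trans cy) ?(lt_trans xc).
Qed.

End Quotient.
End OrbitSpaces.

(** * Locally affine chart expressions *)

Section Calculus.
Variables (R : realType) (n : nat).
Implicit Types (D U : set 'rV[R]_n) (x y : 'rV[R]_n).

Lemma class_Ck_cst (V : normedModType R) k U (c : V) :
  class_Ck k U (fun _ => c).
Proof.
elim: k c => [|k IHk] c;
  (split; first by move=> x _; exact: cst_continuous) => //.
move=> i; split=> [x _|]; first exact: ex_derive.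
under eq_fun do rewrite derive_cst.
exact: IHk.
Qed.

Lemma affine_continuous m (A : 'M[R]_(n, m)) (b : 'rV[R]_m) :
  continuous (fun x => x *m A + b).
Proof.
apply: (@lipschitz_continuous _ _ _ _ (n%:R * `|A| + 1)) => [|x y].
  by rewrite ltr_wpDl // mulr_ge0.
rewrite opprD addrACA subrr addr0 -mulmxBl (le_trans (mulmx_norm_le _ _)) //.
by rewrite ler_wpM2r // lerDl.
Qed.

Lemma is_derive_affine m (A : 'M[R]_(n, m)) (b : 'rV[R]_m) x v :
  is_derive x v (fun y => y *m A + b) (v *m A).
Proof.
have q : \forall h \near 0^', h^-1 *: (((fun y => y *m A + b) \o shift x)
    (h *: v) - (x *m A + b)) = v *m A.
  near=> h; rewrite /= mulmxDl -[_ *m A + _ + b]addrA addrK.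
  have h0 : h != 0 by near: h; exact: nbhs_dnbhs_neq.
  by rewrite -scalemxAl scalerA mulVf // scale1r.
split; first by apply: is_cvg_near_cst; exact: q.
by apply: lim_near_cst => //; exact: norm_hausdorff.
Unshelve. all: by end_near. Qed.

Lemma class_Ck_affine m k U (A : 'M[R]_(n, m)) (b : 'rV[R]_m) :
  class_Ck k U (fun x => x *m A + b).
Proof.
case: k => [|k]; (split; first by move=> x _; exact: affine_continuous) => //.
move=> i; split=> [x _|].
  by have [] := is_derive_affine A b x (delta_mx 0 i).
under eq_fun => x do
  rewrite (@derive_val _ _ _ _ _ _ _ (is_derive_affine A b x _)).
exact: class_Ck_cst.
Qed.

Lemma smooth_on_cst (V : normedModType R) D (F : 'rV[R]_n -> V) (c : V) :
  (forall x, D x -> F x = c) -> smooth_on D F.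
Proof.
move=> Fc x Dx; exists setT, (fun _ => c); split=> // [|k|y _ Dy].
- exact: openT.
- exact: class_Ck_cst.
- exact: Fc.
Qed.

Definition locally_affine_on m D (F : 'rV[R]_n -> 'rV[R]_m) x
    (A : 'M[R]_(n, m)) (b : 'rV[R]_m) :=
  exists2 U, open_nbhs x U & forall y, U y -> D y -> F y = y *m A + b.

Lemma smooth_on_locally_affine m D (F : 'rV[R]_n -> 'rV[R]_m) :
  (forall x, D x -> exists A b, locally_affine_on D F x A b) -> smooth_on D F.
Proof.
move=> FD x Dx; have [A [b [U [oU Ux] FU]]] := FD x Dx.
exists U, (fun y => y *m A + b); split=> // k; exact: class_Ck_affine.
Qed.

(** This makes the filter in [partial] proper, so that its limit is unique. It holds for open sets
    and also for relatively open subsets of a half-space, where increments may be available on one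
    side only. *)
Definition axis_dense D := forall x (i : 'I_n) (e : R), D x -> 0 < e ->
  exists h, [/\ h != 0, `|h| < e & D (x + h *: delta_mx 0 i)].

Lemma norm_delta_mx_le (i : 'I_n) : `|delta_mx 0 i : 'rV[R]_n| <= 1.
Proof.
apply: mx_norm_le => // j k; rewrite mxE.
by case: (_ && _); rewrite ?normr1 ?normr0.
Qed.

Lemma open_axis_ball U x : open_nbhs x U ->
  exists2 e : R, 0 < e &
    forall i h, `|h| < e -> U (x + h *: delta_mx 0 i).
Proof.
move=> /open_nbhs_nbhs /nbhs_normP [e /= e0 xe]; exists e => // i h he.
apply: xe => /=; rewrite opprD addrA subrr add0r normrN normrZ.
by apply: le_lt_trans he; rewrite ler_piMr // norm_delta_mx_le.
Qed.

Lemma open_axis_dense U : open U -> axis_dense U.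
Proof.
move=> oU x i e Ux e0; have [d d0 dU] := @open_axis_ball U x (conj oU Ux).
have m0 : 0 < Num.min d e by rewrite lt_min d0.
have md : `|Num.min d e / 2| < Num.min d e.
  by rewrite gtr0_norm ?divr_gt0 // ltr_pdivrMr // ltr_pMr // ltr1n.
exists (Num.min d e / 2); split; first by rewrite gt_eqF // divr_gt0.
  by rewrite (lt_le_trans md) // ge_min lexx orbT.
by apply: dU; rewrite (lt_le_trans md) // ge_min lexx.
Qed.

Lemma axis_dense_proper D x (i : 'I_n) : axis_dense D -> D x ->
  ProperFilter (within [set h : R | D (x + h *: delta_mx 0 i)] (0 : R)^').
Proof.
move=> dD Dx; apply: Build_ProperFilter_ex => P.
rewrite /within /= /dnbhs /= => /nbhs_normP [e /= e0 eP].
have [h [h0 he Dh]] := dD x i e Dx e0.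
by exists h; apply: eP => //=; rewrite sub0r normrN.
Qed.

(** The difference quotient is equal to [w] for all small admissible increments, so the limit is
    that of a constant. *)
Lemma partial_near (V : normedModType R) D i (F : 'rV[R]_n -> V) x (w : V) :
  axis_dense D -> D x ->
  (exists2 e : R, 0 < e & forall h, `|h| < e -> D (x + h *: delta_mx 0 i) ->
    F (x + h *: delta_mx 0 i) - F x = h *: w) ->
  partial D i F x = w.
Proof.
move=> dD Dx [e e0 eF]; rewrite /partial.
have := axis_dense_proper i dD Dx => pF.
apply: lim_near_cst; first exact: norm_hausdorff.
rewrite /within /= /dnbhs /=; apply/nbhs_normP; exists e => // h /=.
rewrite sub0r normrN => he h0 Dh.
by rewrite eF // scalerA mulVf // scale1r.
Qed.

Lemma partial_cst (V : normedModType R) D i (F : 'rV[R]_n -> V) x (c : V) :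
  axis_dense D -> (forall y, D y -> F y = c) -> D x -> partial D i F x = 0.
Proof.
move=> dD Fc Dx; apply: partial_near => //; exists 1 => // h _ Dh.
by rewrite !Fc // subrr scaler0.
Qed.

Lemma jacobian_locally_affine m D (F : 'rV[R]_n -> 'rV[R]_m) x A b :
  axis_dense D -> D x -> locally_affine_on D F x A b -> Defs.jacobian D F x = A.
Proof.
move=> dD Dx [U xU FU]; apply/matrixP => i j; rewrite mxE.
rewrite (@partial_near _ _ _ _ _ (row i A)) // ?mxE //.
have [e e0 eU] := open_axis_ball xU; exists e => // h he Dh.
rewrite FU //; last exact: eU.
rewrite FU //; last by case: xU.
by rewrite opprD addrACA subrr addr0 -mulmxBl addrC addKr -scalemxAl -rowE.
Qed.

Lemma christoffel_cst D (G : 'rV[R]_n -> 'M[R]_n) G0 k a b x :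
  axis_dense D -> (forall y, D y -> G y = G0) -> D x ->
  christoffel D G k a b x = 0.
Proof.
move=> dD GG0 Dx; rewrite /christoffel big1 ?mulr0 // => l _.
have part0 i p q : partial D i (fun y => G y p q : R^o) x = 0.
  by apply: (@partial_cst _ _ _ _ _ (G0 p q)) => // y Dy; rewrite GG0.
by rewrite !part0 addr0 subr0 mulr0.
Qed.

Lemma riemann_curvature_cst D (G : 'rV[R]_n -> 'M[R]_n) G0 l k i j x :
  axis_dense D -> (forall y, D y -> G y = G0) -> D x ->
  riemann_curvature D G l k i j x = 0.
Proof.
move=> dD GG0 Dx.
have chr0 p q r y : D y -> christoffel D G p q r y = 0.
  exact: (christoffel_cst p q r dD GG0).
have part0 s p q r : partial D s (christoffel D G p q r : _ -> R^o) x = 0.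
  by apply: (@partial_cst R^o _ _ _ _ 0) => // y; exact: chr0.
rewrite /riemann_curvature !part0 subr0 add0r big1 // => m _.
by rewrite !chr0 // !mulr0 subr0.
Qed.

End Calculus.

(** * Maps between manifolds that are affine in charts *)

Section ChartExpressions.
Variables (R : realType) (n m : nat).
Variables (M : riemannian_data R n) (N : riemannian_data R m) (f : M -> N).

Lemma in_chart_coord (V : normedModType R) (i : chart M) (F : M -> V) p :
  set_inj (dom i) (Defs.coord i) -> dom i p ->
  in_chart i F (Defs.coord i p) = F p.
Proof.
move=> iinj ip; rewrite /in_chart.
case: xgetP => [v _ [q [iq qp] <-]|/(_ (F p))].
  by congr F; apply: iinj => //; exact/mem_set.
by case; exists p.
Qed.

(** Stated on points of the manifold rather than on coordinates, so that it can be checked without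
    unfolding [in_chart]. *)
Definition chart_affine (i : chart M) (j : chart N) (p : M)
    (A : 'M[R]_(n, m)) (b : 'rV[R]_m) :=
  exists2 W, open_nbhs (Defs.coord i p) W & forall q, dom i q -> dom j (f q) ->
    W (Defs.coord i q) -> Defs.coord j (f q) = Defs.coord i q *m A + b.

Hypothesis inj_coord : forall i : chart M, set_inj (dom i) (Defs.coord i).

Lemma chart_affine_locally i j p A b : chart_affine i j p A b ->
  locally_affine_on (Defs.coord i @` (dom i `&` f @^-1` dom j))
    (in_chart i (fun p => Defs.coord j (f p))) (Defs.coord i p) A b.
Proof.
move=> [W pW WA]; exists W => // x Wx [q [iq jfq] qx]; subst x.
by rewrite in_chart_coord // WA.
Qed.

Lemma smooth_map_chart_affine : continuous f ->
  (forall i j p, dom i p -> dom j (f p) ->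
     exists A b, chart_affine i j p A b) ->
  smooth_map f.
Proof.
move=> fc fA; split=> // i j; apply: smooth_on_locally_affine.
move=> _ [p [ip jfp] <-]; have [A [b Ab]] := fA i j p ip jfp.
by exists A, b; exact: chart_affine_locally.
Qed.

(** The differential is the linear part [A], so between identity metrics the condition reads 1 = A
    A^T. *)
Lemma preserves_metric_chart_affine :
  (forall (i : chart M) p, dom i p -> metric i p = 1%:M) ->
  (forall (j : chart N) q, dom j q -> metric j q = 1%:M) ->
  (forall i j, axis_dense (Defs.coord i @` (dom i `&` f @^-1` dom j))) ->
  (forall i j p, dom i p -> dom j (f p) ->
     exists A b, A *m A^T = 1%:M /\ chart_affine i j p A b) ->
  preserves_metric f.
Proof.
move=> M1 N1 thick fA i j p ip jfp; have [A [b [AAT Ab]]] := fA i j p ip jfp.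
rewrite /differential (jacobian_locally_affine (A := A) (b := b)) //.
- by rewrite M1 // N1 // mulmx1.
- by exists p.
- exact: chart_affine_locally.
Qed.

End ChartExpressions.

(** * Bieberbach groups with holonomy of order 2 *)

Section AffineGroup.
Variables (R : realType) (n : nat).
Implicit Types (x y : 'rV[R]_n) (g h k : affine_map R n).

(** The value at 0 determines the translation part, the values at the basis vectors the rows of the
    matrix. Identities between affine maps can thus be checked pointwise. *)
Lemma affine_act_ext g h : affine_act g =1 affine_act h -> g = h.
Proof.
case: g h => [A b] [B c] gh.
have bc : b = c by have := gh 0; rewrite /affine_act /= !mul0mx !add0r.
congr pair => //; apply/row_matrixP => i.
by have := gh (delta_mx 0 i); rewrite /affine_act /= -!rowE bc => /addIr.
Qed.

Variable Gamma : set (affine_map R n).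
Hypothesis hGamma : is_isometry_group Gamma.

Lemma isometry_group_comp_inv g : Gamma g -> exists h,
  [/\ Gamma h, affine_comp h g = affine_id R n
    & affine_comp g h = affine_id R n].
Proof.
move=> gG; have [h [hG gK hK]] := isometry_group_inv hGamma gG.
by exists h; split=> //; apply: affine_act_ext => x;
  rewrite affine_actM affine_act_id ?gK ?hK.
Qed.

Lemma affine_compA g h k :
  affine_comp g (affine_comp h k) = affine_comp (affine_comp g h) k.
Proof. by apply: affine_act_ext => x; rewrite !affine_actM. Qed.

Lemma affine_comp_idl g : affine_comp (affine_id R n) g = g.
Proof. by apply: affine_act_ext => x; rewrite affine_actM affine_act_id. Qed.

Lemma affine_comp_idr g : affine_comp g (affine_id R n) = g.
Proof. by apply: affine_act_ext => x; rewrite affine_actM affine_act_id. Qed.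

Lemma same_linear_part g h : Gamma g -> Gamma h -> g.1 = h.1 ->
  exists t, translations Gamma t /\ g = affine_comp h t.
Proof.
move=> gG hG gh; have [h' [h'G h'h hh']] := isometry_group_comp_inv hG.
exists (affine_comp h' g); split; last first.
  by rewrite affine_compA hh' affine_comp_idl.
split; first exact: (ig_comp hGamma).
by rewrite /= gh; have := congr1 fst h'h.
Qed.

(** This replaces the holonomy group, a set of cosets, by the set of linear parts of [Gamma]. *)
Lemma translation_coset_eqP g h : Gamma g -> Gamma h ->
  translation_coset Gamma g = translation_coset Gamma h <-> g.1 = h.1.
Proof.
move=> gG hG; split=> [gh|gh].
  have : translation_coset Gamma g g.
    exists (affine_id R n); last exact: affine_comp_idr.
    by split=> //; exact: (ig_id hGamma).
  by rewrite gh => -[t [_ t1] <-]; rewrite /= t1 mul1mx.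
have sub g1 g2 : Gamma g1 -> Gamma g2 -> g1.1 = g2.1 ->
    translation_coset Gamma g1 `<=` translation_coset Gamma g2.
  move=> g1G g2G g12 _ [t [tG t1] <-].
  have [||s [sG ->]] := @same_linear_part (affine_comp g1 t) g2 _ g2G.
  - exact: (ig_comp hGamma).
  - by rewrite /= t1 mul1mx.
  - by exists s.
by rewrite eqEsubset; split; exact: sub.
Qed.

Lemma translation_sub g h : Gamma g -> Gamma h -> g.1 = h.1 ->
  Gamma (1%:M, g.2 - h.2).
Proof.
move=> gG hG gh; have [k [kG kh hk]] := isometry_group_comp_inv hG.
suff -> : (1%:M, g.2 - h.2) = affine_comp g k by exact: (ig_comp hGamma).
have [] := hk => k1 k2; rewrite /affine_comp gh k1; congr pair.
by apply/eqP; rewrite subr_eq addrAC k2 add0r.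
Qed.

Lemma translation_add x g : Gamma (1%:M, x) -> Gamma g ->
  Gamma (g.1, g.2 + x).
Proof.
move=> xG gG; have := ig_comp hGamma xG gG.
by rewrite /affine_comp /= !mulmx1.
Qed.

Lemma translation_opp x : Gamma (1%:M, x) -> Gamma (1%:M, - x).
Proof.
move=> xG; have := translation_sub (ig_id hGamma) xG erefl.
by rewrite /= sub0r.
Qed.

Lemma translation_mulz x (m : int) :
  Gamma (1%:M, x) -> Gamma (1%:M, m%:~R *: x).
Proof.
move=> xG.
have xnG (k : nat) : Gamma (1%:M, k%:R *: x).
  elim: k => [|k IHk]; first by rewrite scale0r; exact: (ig_id hGamma).
  rewrite mulrS scalerDl scale1r addrC.
  exact: (translation_add xG IHk).
case: m => k; first exact: xnG.
rewrite NegzE mulrNz scaleNr; exact: (translation_opp (xnG _)).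
Qed.

Lemma translation_conj x g : Gamma (1%:M, x) -> Gamma g ->
  Gamma (1%:M, x *m g.1).
Proof.
move=> xG gG; have := translation_sub (ig_comp hGamma gG xG) gG.
by rewrite /= mul1mx addrK; apply.
Qed.

Lemma translations_discrete : isolated Gamma = Gamma ->
  exists2 e : R, 0 < e & forall x, Gamma (1%:M, x) -> `|x| < e -> x = 0.
Proof.
move=> iG; have : isolated Gamma (affine_id R n).
  by rewrite iG; exact: (ig_id hGamma).
case=> _ [V [[P Q] /= [P1 /nbhs_normP [e /= e0 Qe]] PQV] VG].
exists e => // x xG xe.
have : (V `&` Gamma) (1%:M, x).
  split=> //; apply: PQV; split=> /=; first exact: nbhs_singleton.
  by apply: Qe; rewrite /= sub0r normrN.
by rewrite VG => -[].
Qed.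

(** Induction on the list of linear parts. By the separation hypothesis, elements with a given
    linear part send [x] to at most one point within e / 2 of [y]; if that point is not [y], then
    [d] is shrunk to exclude it. *)
Lemma discrete_orbit (s : seq 'M[R]_n) (e : R) :
  (forall g, Gamma g -> g.1 \in s) -> 0 < e ->
  (forall g h, Gamma g -> Gamma h -> g.1 = h.1 -> `|g.2 - h.2| < e ->
    g.2 = h.2) ->
  forall x y, exists2 d : R, 0 < d &
    forall g, Gamma g -> `|affine_act g x - y| < d -> affine_act g x = y.
Proof.
move=> Gs e0 sep x y.
suff [d d0 dP] : exists2 d : R, 0 < d & forall g, Gamma g -> g.1 \in s ->
    `|affine_act g x - y| < d -> affine_act g x = y.
  by exists d => // g gG; apply: dP => //; exact: Gs.
elim: s {Gs} => [|B s [d d0 dP]]; first by exists 1.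
have [[g0 [g0G g0B g0x g0e]]|none] := pselect (exists g0,
  [/\ Gamma g0, g0.1 = B, affine_act g0 x != y
    & `|affine_act g0 x - y| < e / 2]).
  have m0 : 0 < `|affine_act g0 x - y| by rewrite normr_gt0 subr_eq0.
  exists (Num.min d `|affine_act g0 x - y|); first by rewrite lt_min d0.
  move=> g gG; rewrite inE => /orP[/eqP gB|gs]; rewrite lt_min => /andP[gd gg0];
    last exact: dP.
  have gg : g.2 = g0.2.
    apply: sep => //; first by rewrite gB.
    have -> : g.2 - g0.2 = affine_act g x - y + (y - affine_act g0 x).
      by rewrite subrKA /affine_act gB g0B opprD addrACA subrr add0r.
    rewrite (le_lt_trans (ler_normD _ _)) // (splitr e) ltrD //.
      exact: lt_trans gg0 g0e.
    by rewrite distrC.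
  by move: gg0; rewrite /affine_act gB gg g0B ltxx.
exists (Num.min d (e / 2)); first by rewrite lt_min d0 divr_gt0.
move=> g gG; rewrite inE => /orP[/eqP gB|gs]; rewrite lt_min => /andP[gd ge];
  last exact: dP.
by apply/eqP/negP => /negP gx; apply: none; exists g.
Qed.

End AffineGroup.

(** * The half translation provided by holonomy of order 2 *)

Section HolonomyZ2.
Variables (R : realType) (n : nat) (Gamma : set (affine_map R n)).
Hypotheses (hGamma : is_bieberbach Gamma) (hol : holonomy_isog_Z2 Gamma).
Let hgrp := bb_group hGamma.

(** The coset sent to 1 by the isomorphism provides [g]: 1 differs from 0, 1 + 1 = 0, and 0 and 1
    are the only values. *)
Lemma holonomy_Z2_linear_part : exists g, [/\ Gamma g, g.1 != 1%:M,
  g.1 *m g.1 = 1%:M & forall h, Gamma h -> h.1 = 1%:M \/ h.1 = g.1].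
Proof.
case: hol => f [[fun_f inj_f surj_f] fM].
have idG := ig_id hgrp.
have f1 : f (translation_coset Gamma (affine_id R n)) = 0.
  have := fM _ _ idG idG; rewrite affine_comp_idl => /esym/eqP.
  by rewrite -subr_eq0 addrK => /eqP.
have [c [g gG gc] fc] := surj_f 1 I.
have finj h k : Gamma h -> Gamma k ->
    f (translation_coset Gamma h) = f (translation_coset Gamma k) ->
    h.1 = k.1.
  move=> hG kG fhk; apply/(translation_coset_eqP hgrp hG kG).
  by apply: inj_f => //; apply/mem_set; [exists h|exists k].
exists g; split=> //.
- apply/eqP => g1.
  have /(translation_coset_eqP hgrp gG idG) gid : g.1 = (affine_id R n).1 by [].
  by move: fc; rewrite -gc gid f1.
- have ggG := ig_comp hgrp gG gG.
  have -> : g.1 *m g.1 = (affine_comp g g).1 by [].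
  apply: (finj _ (affine_id R n)) => //.
  by rewrite fM // gc fc f1; exact: val_inj.
- move=> h hG.
  have [h0|h1] : f (translation_coset Gamma h) = 0 \/
      f (translation_coset Gamma h) = 1.
    case: (f _) => -[|[|//]] lt; [left|right]; exact: val_inj.
  - by left; apply: (finj _ (affine_id R n)) => //; rewrite f1.
  - by right; apply: finj => //; rewrite gc fc.
Qed.

(** Otherwise all translations of [Gamma] are orthogonal to a vector [v] with v A = - v, where A =
    [g.1]. The scalar product with [v] then varies along an orbit only by a sign and a fixed
    constant, so points far out along [v] cannot be brought back to a bounded set, against
    cocompactness. *)
Lemma exists_moved_translation g : Gamma g -> g.1 != 1%:M ->
  g.1 *m g.1 = 1%:M -> (forall h, Gamma h -> h.1 = 1%:M \/ h.1 = g.1) ->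
  exists2 x, Gamma (1%:M, x) & x *m g.1 != x.
Proof.
move=> gG g1 gg gh.
(* An orthogonal involution is symmetric. *)
have gT : g.1^T = g.1.
  have := ig_isometry hgrp gG; rewrite /is_isometry => gi.
  by rewrite -[LHS]mul1mx -gg -mulmxA gi mulmx1.
apply: contrapT => fixed.
have {}fixed x : Gamma (1%:M, x) -> x *m g.1 = x.
  by move=> xG; apply/eqP/negP => /negP xg; apply: fixed; exists x.
have [i vi] : exists i, row i (1%:M - g.1) != 0.
  apply/existsP; move: g1; apply: contraNT; rewrite negb_exists => /forallP v0.
  rewrite eq_sym -subr_eq0; apply/eqP/row_matrixP => i; rewrite row0.
  by apply/eqP; have := v0 i; rewrite negbK.
pose v := row i (1%:M - g.1).
have vg : v *m g.1 = - v.
  by rewrite /v -row_mul mulmxBl mul1mx gg -linearN /= opprB.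
pose dot (x : 'rV[R]_n) : R := (x *m v^T) 0 0.
have dotD x y : dot (x + y) = dot x + dot y by rewrite /dot mulmxDl mxE.
have dotg x : dot (x *m g.1) = - dot x.
  by rewrite /dot -mulmxA -[X in X *m v^T]gT -trmx_mul vg linearN mulmxN mxE.
have dot0 x : Gamma (1%:M, x) -> dot x = 0.
  move=> /fixed xg; have := dotg x; rewrite xg => xx; lra.
have [M bM] := (compact_orbit_spaceP hgrp).1 (bb_cocompact hGamma).
have vv : 0 < dot v.
  rewrite /dot mxE lt_neqAle eq_sym; apply/andP; split; last first.
    by apply: sumr_ge0 => j _; rewrite !mxE -expr2 sqr_ge0.
  move: vi; apply: contra => /eqP v0; apply/eqP/rowP => j; rewrite -/v [RHS]mxE.
  move/eqP: v0; rewrite psumr_eq0 => [/allP /(_ j)|k _]; last first.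
    by rewrite !mxE -expr2 sqr_ge0.
  rewrite mem_index_enum => /(_ isT) /implyP /(_ isT).
  by rewrite [v^T _ _]mxE mulf_eq0 orbb => /eqP.
pose C := n%:R * `|v^T| * M.
have bC x : exists2 h, Gamma h & `|dot (affine_act h x)| <= C.
  have [h hG hx] := bM x; exists h => //.
  apply: (le_trans (coef_le_mx_norm _ _ _)).
  apply: (le_trans (mulmx_norm_le _ _)).
  by rewrite ler_wpM2l // mulr_ge0.
(* Elements with the same linear part differ by a translation, on which [dot] vanishes, so [dot h.2]
   is 0 or [dot g.2]. *)
have doth h x : Gamma h ->
    dot (affine_act h x) = dot x \/ dot (affine_act h x) = - dot x + dot g.2.
  move=> hG; rewrite /affine_act dotD; have [h1|h1] := gh h hG.
    left; rewrite h1 mulmx1 (_ : dot h.2 = 0) ?addr0 //; apply: dot0.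
    by rewrite -h1 -surjective_pairing.
  right; rewrite h1 dotg; congr (_ + _).
  have /dot0 := translation_sub hgrp hG gG h1.
  by rewrite dotD /dot mulNmx !mxE => /eqP; rewrite subr_eq0 => /eqP.
(* Chosen so that both possible values of [dot] on the orbit of [s *: v] exceed [C] in absolute
   value. *)
pose s := (`|C| + `|dot g.2| + 1) / dot v.
have dots : dot (s *: v) = `|C| + `|dot g.2| + 1.
  by rewrite /dot -scalemxAl mxE -/(dot v) /s divfK // gt_eqF.
have [h hG] := bC (s *: v).
have := ler_norm C; have := ler_norm (dot g.2); have := normr_ge0 C.
have := normr_ge0 (dot g.2).
case: (doth h (s *: v) hG) => ->; rewrite dots ler_norml => ? ? ? ? /andP[];
  lra.
Qed.

Lemma exists_half_translation : exists A t,
  [/\ forall g, Gamma g -> g.1 = 1%:M \/ g.1 = A, A != 1%:M, t *m A = - t,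
     Gamma (1%:M, 2 *: t) & ~ Gamma (1%:M, t)].
Proof.
have [g [gG g1 gg gh]] := holonomy_Z2_linear_part.
have [x xG xg] := exists_moved_translation gG g1 gg gh.
pose m := x - x *m g.1.
have mG : Gamma (1%:M, m).
  exact: (translation_sub hgrp xG (translation_conj hgrp xG gG)).
have m0 : m != 0 by rewrite subr_eq0 eq_sym.
have mg : m *m g.1 = - m by rewrite mulmxBl -mulmxA gg mulmx1 opprB.
have [e e0 eP] := translations_discrete hgrp (bb_discrete hGamma).
(* Repeated halving must leave [Gamma], since a translation of [Gamma] shorter than [e] is zero. *)
have ex : exists k, `[< ~ Gamma (1%:M, (2^-1 ^+ k) *: m) >].
  have [k ke] : exists k, `|m| / e < 2 ^+ k.
    exists (Num.bound (`|m| / e)).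
    apply: (lt_trans (archi_boundP _)); first by rewrite divr_ge0 // ltW.
    by rewrite -natrX ltr_nat ltn_expl.
  exists k; apply/asboolP => /eP; rewrite normrZ ger0_norm; last first.
    by rewrite exprn_ge0 // invr_ge0.
  rewrite exprVn -ltr_pdivlMl ?invr_gt0 ?exprn_gt0 // invrK.
  rewrite -ltr_pdivrMr // => /(_ ke) /eqP.
  by rewrite scaler_eq0 (negbTE m0) orbF invr_eq0 expf_eq0 pnatr_eq0 andbF.
(* The least exponent is not 0 because [m] lies in [Gamma]; one halving earlier, the vector still
   gives a translation of [Gamma], and this is [2 *: t]. *)
case: (ex_minnP ex) => -[/asboolP|k /asboolP nk mink].
  by rewrite expr0 scale1r.
exists g.1, ((2^-1 ^+ k.+1) *: m); split=> //.
  by rewrite -scalemxAl mg scalerN.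
rewrite scalerA exprS mulrA mulfV ?mul1r //.
apply: contrapT => nG; have /mink : `[< ~ Gamma (1%:M, (2^-1 ^+ k) *: m) >].
  exact/asboolP.
by rewrite ltnn.
Qed.

End HolonomyZ2.

(** * The flat manifold bounded by the Bieberbach manifold *)

Section Cylinder.
Variables (R : realType) (n : nat).

Definition cyl (u : R) (y : 'rV[R]_n) : 'rV[R]_n.+1 :=
  row_mx (u%:M : 'M[R]_1) y.

Lemma cyl_head u y : cyl u y 0 ord0 = u.
Proof.
rewrite /cyl mxE; case: splitP => // j _.
by rewrite mxE !ord1 eqxx mulr1n.
Qed.

Lemma cyl_tail u y : col' ord0 (cyl u y) = y.
Proof.
apply/rowP => j; rewrite mxE /cyl mxE; case: splitP => k /= jk.
  by move: (ltn_ord k); rewrite -jk.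
move: jk; rewrite /bump leq0n => /eqP; rewrite eqn_add2l => /eqP jk.
by congr (y _ _); exact: val_inj.
Qed.

Lemma cylK (x : 'rV[R]_n.+1) : cyl (x 0 ord0) (col' ord0 x) = x.
Proof.
apply/rowP => j; case: (unliftP ord0 j) => [k ->|->]; last by rewrite cyl_head.
by have /rowP/(_ k) := cyl_tail (x 0 ord0) (col' ord0 x); rewrite !mxE.
Qed.

Lemma cylP (x : 'rV[R]_n.+1) : exists u y, x = cyl u y.
Proof. by exists (x 0 ord0), (col' ord0 x); rewrite cylK. Qed.

Lemma cylB u y u' y' : cyl u y - cyl u' y' = cyl (u - u') (y - y').
Proof.
by rewrite /cyl (@opp_row_mx _ 1 1 n) (@add_row_mx _ 1 1 n) -raddfN -raddfD.
Qed.

Lemma norm_cyl_le u y (M : R) : `|u| <= M -> `|y| <= M -> `|cyl u y| <= M.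
Proof.
move=> uM yM; apply: mx_norm_le => [|i j]; first exact: le_trans uM.
rewrite (ord1 i); case: (unliftP ord0 j) => [k ->|->]; last by rewrite cyl_head.
have /rowP/(_ k) := cyl_tail u y; rewrite mxE => ->.
exact: le_trans (coef_le_mx_norm _ _ _) yM.
Qed.

Lemma norm_cylE_le u y (M : R) : `|cyl u y| <= M -> `|u| <= M /\ `|y| <= M.
Proof.
move=> M0; split.
  by rewrite -(cyl_head u y) (le_trans (coef_le_mx_norm _ _ _)).
apply: mx_norm_le => [|i j]; first exact: le_trans M0.
rewrite -(cyl_tail u y) mxE (ord1 i).
exact: le_trans (coef_le_mx_norm _ _ _) M0.
Qed.

End Cylinder.

(** * The group acting on R * R^n *)

Section CollarGroup.
Variables (R : realType) (n : nat) (Gamma : set (affine_map R n)).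
Variables (A : 'M[R]_n) (t : 'rV[R]_n).
Hypotheses (hGamma : is_bieberbach Gamma).
Hypotheses (linA : forall g, Gamma g -> g.1 = 1%:M \/ g.1 = A) (A1 : A != 1%:M).
Hypotheses (tA : t *m A = - t) (t2 : Gamma (1%:M, 2 *: t)).
Hypothesis (tN : ~ Gamma (1%:M, t)).
Let hgrp := bb_group hGamma.

Lemma even_shift (k : int) g : Gamma g ->
  Gamma (g.1, g.2 + (2 * k)%:~R *: t).
Proof.
move=> gG; apply: (translation_add hgrp) => //.
by rewrite intrM mulrC -scalerA; exact: translation_mulz.
Qed.

(** Freeness of the involution induced by [t]. The even part of the shift is absorbed into some [h]
    in [Gamma], leaving h y + t = y. If [h] is a translation, it is the one by - t, so [t] would
    give a translation of [Gamma]. Otherwise, adding the equation to its image under [A] gives h.2 A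
    = - h.2, so [h] fixes h.2 / 2, against freeness of [Gamma]. *)
Lemma odd_shift_free (k : int) g y : Gamma g ->
  affine_act g y + (2 * k + 1)%:~R *: t <> y.
Proof.
move=> gG; have [h hG hE] : exists2 h, Gamma h &
    affine_act h y = affine_act g y + (2 * k)%:~R *: t.
  exists (g.1, g.2 + (2 * k)%:~R *: t); first exact: even_shift.
  by rewrite /affine_act /= addrA.
rewrite intrD scalerDl scale1r addrA -hE.
move=> fixy; have [h1|hA] := linA hG.
  move: fixy; rewrite /affine_act h1 mulmx1 -addrA.
  move=> /(canRL (addKr y)) /eqP; rewrite addNr addr_eq0 => /eqP ht; apply: tN.
  have := translation_opp hgrp (x := h.2).
  rewrite -h1 -surjective_pairing ht opprK.
  by rewrite h1; apply.
(* The linear part A A of the square of [h] is 1 or [A]; the latter would force A = 1, as [A] is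
   invertible. *)
have fixA : y *m A *m A = y.
  have := ig_isometry hgrp hG; rewrite /is_isometry hA => AT.
  have := ig_comp hgrp hG hG => hhG.
  have [AA|AA] := linA hhG.
    by rewrite -mulmxA; move: AA; rewrite /= hA => ->; rewrite mulmx1.
  move: AA; rewrite /= hA => AA; case/eqP: A1.
  by rewrite -[LHS]mulmx1 -AT mulmxA AA.
have hh0 : h.2 *m A + h.2 = 0.
  move: fixy; rewrite /affine_act hA => yA.
  have := congr1 (mulmx^~ A) yA; rewrite !mulmxDl fixA tA => yAA.
  apply/rowP => j; have /rowP/(_ j) := yA; have /rowP/(_ j) := yAA.
  by rewrite !mxE; lra.
have : h = affine_id R n.
  apply: (bb_free hGamma (x := 2^-1 *: h.2)) => //.
  rewrite /affine_act hA -scalemxAl; apply/eqP; rewrite -subr_eq0.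
  rewrite (_ : h.2 *m A = - h.2); last by apply/eqP; rewrite -addr_eq0 hh0.
  by apply/eqP/rowP => j; rewrite !mxE; field.
by move=> hid; move: A1; rewrite -hA hid eqxx.
Qed.

Definition collar_map (b : bool) (k : int) (h : affine_map R n) :
    affine_map R n.+1 :=
  (block_mx (((-1) ^+ b)%:M : 'M[R]_1) 0 0 h.1 : 'M[R]_n.+1,
   cyl k%:~R (h.2 + k%:~R *: t)).

Lemma collar_act b k h u y : affine_act (collar_map b k h) (cyl u y) =
  cyl ((-1) ^+ b * u + k%:~R) (affine_act h y + k%:~R *: t).
Proof.
rewrite /affine_act /collar_map /cyl /= (@mul_row_block _ 1 1 n 1 n).
rewrite !mulmx0 addr0 add0r -scalar_mxM (@add_row_mx _ 1 1 n) -raddfD /= addrA.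
by rewrite mulrC.
Qed.

(* The elements act by (u, y) |-> (+- u + k, g y + k t).  Those with g the
   translation by - k t, k even, and sign - are the reflections in the
   integers, which fold R onto [0, 1]; those with k odd identify (u, y) with
   (1 - u, y + t) up to them and Gamma. *)
Definition collar_group : set (affine_map R n.+1) :=
  [set g | exists b k h, Gamma h /\ g = collar_map b k h].

(** As t h.1 is t or - t, the left side is 0 or a multiple of 2 k t. This is the failure of the
    shift by [k t] to commute with [h] up to the sign, and being even it can be absorbed into
    [Gamma]. *)
Lemma shift_linear (k : int) h (b : bool) : Gamma h ->
  exists m : int, k%:~R *: (t *m h.1 - (-1) ^+ b *: t) = (2 * m)%:~R *: t.
Proof.
move=> /linA [->|->]; rewrite ?mulmx1 ?tA; case: b; rewrite /= ?expr0 ?expr1.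
- exists k; rewrite intrM mulrC -scalerA scaleN1r opprK -mulr2n -scaler_nat.
  by rewrite [2%:~R]/2%:~R.
- by exists 0; rewrite scale1r subrr mulr0 scale0r scaler0.
- by exists 0; rewrite scaleN1r opprK addNr mulr0 scale0r scaler0.
- exists (- k); rewrite scale1r -opprD -mulr2n -scaler_nat scalerN mulrN mulrNz.
  by rewrite scaleNr intrM mulrC scalerA.
Qed.

Lemma collar_comp b k h b' k' h' : Gamma h -> Gamma h' ->
  exists2 h'', Gamma h'' & affine_comp (collar_map b k h)
    (collar_map b' k' h') = collar_map (b (+) b') ((-1) ^+ b * k' + k) h''.
Proof.
move=> hG h'G; have [m mP] := shift_linear k' b hG.
have hh'G := ig_comp hgrp hG h'G; have := even_shift m hh'G.
set h'' := (_, _) => h''G.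
exists h'' => //.
apply: affine_act_ext => x; have [u [y ->]] := cylP x.
rewrite affine_actM !collar_act; congr cyl.
  by rewrite intrD intrM rmorphXn rmorphN1 signr_addb mulrDr addrA mulrA.
have -> : affine_act h'' y = affine_act h (affine_act h' y) + (2 * m)%:~R *: t.
  by rewrite -affine_actM /affine_act /= addrA.
rewrite -mP intrD intrM rmorphXn rmorphN1 /affine_act !mulmxDl.
rewrite scalerBr scalerDl scalerA -scalemxAl.
by rewrite [_%:~R * _]mulrC; apply/rowP => j; rewrite !mxE; ring.
Qed.

Lemma collar_group_isometry : is_isometry_group collar_group.
Proof.
have compG g h : collar_group g -> collar_group h ->
    collar_group (affine_comp g h).
  move=> [b [k [g' [gG ->]]]] [b' [k' [h' [hG ->]]]].
  have [h'' h''G ->] := collar_comp b k b' k' gG hG.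
  by exists (b (+) b'), ((-1) ^+ b * k' + k), h''.
have id_collar : collar_map false 0 (affine_id R n) = affine_id R n.+1.
  apply: affine_act_ext => x; have [u [y ->]] := cylP x.
  by rewrite collar_act !affine_act_id mul1r !addr0 scale0r addr0.
split=> //.
- move=> _ [b [k [h [hG ->]]]]; rewrite /is_isometry /=.
  rewrite (@tr_block_mx _ 1 n 1 n) (@mulmx_block _ 1 n 1 n 1 n).
  rewrite !trmx0 !mulmx0 !mul0mx !addr0 !add0r tr_scalar_mx -scalar_mxM.
  rewrite -expr2 sqrr_sign (ig_isometry hgrp hG).
  by rewrite -(@scalar_mx_block _ 1 n).
- exists false, 0, (affine_id R n); split=> //; exact: (ig_id hgrp).
- move=> _ [b [k [h [hG ->]]]].
  have [h' [h'G h'h hh']] := isometry_group_comp_inv hgrp hG.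
  (* The shift is chosen to cancel the total shift in [u]; what remains acts on [y] alone by [h1]
     and is undone by its inverse [h2]. *)
  have [h1 h1G e1] := collar_comp b (- ((-1) ^+ b * k)) b k h'G hG.
  have [h2 [h2G h21 _]] := isometry_group_comp_inv hgrp h1G.
  exists (affine_comp (collar_map false 0 h2)
      (collar_map b (- ((-1) ^+ b * k)) h')).
    by apply: compG; [exists false, 0, h2|exists b, (- ((-1) ^+ b * k)), h'].
  rewrite -affine_compA e1 addbb subrr.
  apply: affine_act_ext => x; have [u [y ->]] := cylP x.
  rewrite affine_actM !collar_act !scale0r !addr0 -affine_actM h21.
  by rewrite !affine_act_id /= expr0 !mul1r.
Qed.

Lemma cyl_inj u y u' y' : cyl u y = cyl u' y' -> u = u' /\ y = y' :> 'rV[R]_n.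
Proof.
move=> e; have := congr1 (fun x : 'rV[R]_n.+1 => x 0 ord0) e.
rewrite !cyl_head => ->.
by have := congr1 (col' ord0) e; rewrite !cyl_tail => ->.
Qed.

(** * Orbits, discreteness and cocompactness *)

Local Notation pi := (@orbit_proj R n.+1 collar_group).
Let cgrp := collar_group_isometry.

Lemma collar_orbitP u y u' y' : pi (cyl u y) = pi (cyl u' y') <->
  exists (b : bool) (k : int) h, [/\ Gamma h, u' = (-1) ^+ b * u + k%:~R
    & y' = affine_act h y + k%:~R *: t].
Proof.
split=> [/(orbit_projP cgrp) [_ [b [k [h [hG ->]]]]]|[b [k [h [hG -> ->]]]]].
  by rewrite collar_act => /cyl_inj [<- <-]; exists b, k, h.
apply/(orbit_projP cgrp); exists (collar_map b k h); last exact: collar_act.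
by exists b, k, h.
Qed.

(** An element that keeps u = 0 has k = 0, so the slice u = 0 is glued by [Gamma] alone; this is why
    the boundary is R^n/Gamma. *)
Lemma collar_proj0 y y' :
  pi (cyl 0 y) = pi (cyl 0 y') <-> orbit_proj Gamma y = orbit_proj Gamma y'.
Proof.
split=> [/collar_orbitP [b [k [h [hG]]]]|/(orbit_projP hgrp) [h hG <-]].
  rewrite mulr0 add0r => /esym/eqP; rewrite intr_eq0 => /eqP ->.
  by rewrite scale0r addr0 => ->; apply/(orbit_projP hgrp); exists h.
apply/collar_orbitP; exists false, 0, h.
by rewrite mulr0 add0r scale0r addr0.
Qed.

Lemma int_itv_eq0 (k : int) : 0 <= k%:~R :> R -> k%:~R < 1 :> R -> k = 0.
Proof. by rewrite ler0z ltrz1; lia. Qed.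

Lemma collar_proj_boundary u y y' : 0 <= u -> u < 1 ->
  pi (cyl u y) = pi (cyl 0 y') -> u = 0.
Proof.
move=> u0 u1 /esym/collar_orbitP [b [k [h [_ uk _]]]].
rewrite mulr0 add0r in uk; rewrite uk in u0 u1 *.
by rewrite (int_itv_eq0 u0 u1).
Qed.

(** There are at most four linear parts. If two elements share one and are close, their integer
    shifts differ by less than 1, hence agree, and their [Gamma] parts differ by a translation
    shorter than [e]. *)
Lemma collar_discrete (x x' : 'rV[R]_n.+1) : exists2 d : R, 0 < d &
  forall g, collar_group g -> `|affine_act g x - x'| < d -> affine_act g x = x'.
Proof.
have [e e0 eP] := translations_discrete hgrp (bb_discrete hGamma).
pose lin (b : bool) (B : 'M[R]_n) : 'M[R]_n.+1 :=
  block_mx (((-1) ^+ b)%:M : 'M[R]_1) 0 0 B.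
apply: (discrete_orbit (s := [:: lin true 1%:M; lin false 1%:M;
  lin true A; lin false A]) (e := Num.min 1 e)) => //.
- move=> _ [b [k [h [hG ->]]]]; rewrite !inE /= -!/(lin _ _).
  by case: (linA hG) => ->; case: b; rewrite eqxx ?orbT.
- by rewrite lt_min ltr01.
move=> _ _ [b [k [h [hG ->]]]] [b' [k' [h' [h'G ->]]]] /=.
move=> /(@eq_block_mx _ 1 n 1 n) [_ _ _ hh'].
have -> : cyl k%:~R (h.2 + k%:~R *: t) - cyl k'%:~R (h'.2 + k'%:~R *: t) =
    cyl (k - k')%:~R (h.2 - h'.2 + (k - k')%:~R *: t).
  by rewrite cylB intrB scalerBl opprD addrACA.
rewrite lt_min => /andP[k1 ke].
move: (lexx `|cyl (k - k')%:~R (h.2 - h'.2 + (k - k')%:~R *: t)|).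
move=> /norm_cylE_le [/le_lt_trans /(_ k1) kk1 /le_lt_trans /(_ ke)].
have kk' : k - k' = 0 by move: kk1; rewrite -intr_norm ltrz1; lia.
rewrite kk' scale0r addr0 => he.
have /eqP := eP _ (translation_sub hgrp hG h'G hh') he.
by rewrite subr_eq0 => /eqP ->; move/eqP: kk'; rewrite subr_eq0 => /eqP ->.
Qed.

(** An integer shift brings [u] into [0, 1), and an element of [Gamma] then bounds [y] without
    changing [u]. *)
Lemma collar_compact : compact [set: orbit_space collar_group].
Proof.
apply/(compact_orbit_spaceP cgrp).
have [M bM] := (compact_orbit_spaceP hgrp).1 (bb_cocompact hGamma).
exists (Num.max 1 M) => x; have [u [y ->]] := cylP x.
pose k := - Num.floor u.
have [h hG hM] := bM (y + k%:~R *: t).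
exists (affine_comp (collar_map false 0 h)
  (collar_map false k (affine_id R n))).
  apply: (ig_comp cgrp); first by exists false, 0, h.
  by exists false, k, (affine_id R n); split=> //; exact: (ig_id hgrp).
rewrite affine_actM !collar_act affine_act_id scale0r !addr0 /= expr0 !mul1r.
apply: norm_cyl_le; last by rewrite le_max hM orbT.
rewrite le_max; apply/orP; left; rewrite /k mulrNz.
have := floor_le u; have := floorD1_gt u; rewrite intrD => ? ?.
by rewrite ger0_norm; lra.
Qed.

(** The bound u < 1 makes u = 0 the only height at which a chart meets the orbits of the wall u = 0,
    which are the points of integral height. *)
Definition is_collar_chart (U : set 'rV[R]_n.+1) :=
  [/\ exists2 W, open W & U = @half_space R n `&` W,
     U `<=` [set x | x 0 ord0 < 1] & set_inj U pi].

Definition collar_chart := {U : set 'rV[R]_n.+1 | is_collar_chart U}.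

(** * Existence of charts and transition maps *)

Lemma head_continuous : continuous (fun x : 'rV[R]_n.+1 => x 0 ord0).
Proof. exact: coord_continuous. Qed.

Lemma collar_chart_at u y : 0 <= u -> u <= 2^-1 ->
  exists i : collar_chart, sval i (cyl u y).
Proof.
move=> u0 u1; have [d d0 dP] := collar_discrete (cyl u y) (cyl u y).
(* Isometries of R^(n+1) are (n+1)-Lipschitz, so an element relating two points of the ball of
   radius [e] moves its centre by less than (n + 1) e + e = d, hence fixes it. *)
pose e := d / (n.+1%:R + 1).
have e0 : 0 < e by rewrite divr_gt0 // ltr_wpDl.
pose W := ball (cyl u y) e `&` [set x : 'rV[R]_n.+1 | x 0 ord0 < 1].
have oW : open W.
  apply: openI; first exact: ball_open.
  by apply: open_comp (@open_lt R 1) => x _; exact: head_continuous.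
have Winj : set_inj (@half_space R n `&` W) pi.
  move=> x x' /set_mem [xH [xe _]] /set_mem [x'H [x'e _]] /(orbit_projP cgrp).
  move=> [g gG gx].
  have gfix : affine_act g (cyl u y) = cyl u y.
    apply: dP => //; rewrite -(subrKA x') -{1}gx.
    have -> : d = n.+1%:R * e + e.
      by rewrite /e; field; rewrite gt_eqF // ltr_wpDl.
    rewrite -ball_normE /= in xe x'e.
    rewrite (le_lt_trans (ler_normD _ _)) // ler_ltD //; last by rewrite distrC.
    rewrite (le_trans (isometry_lipschitz _ _ (ig_isometry cgrp gG))) //.
    by rewrite ler_wpM2l // ltW.
  move: gG gx gfix => [b [k [h [hG ->]]]] gx; rewrite collar_act.
  move=> /cyl_inj [uk yk].
  have [m [km|km]] : exists m : int, k = 2 * m \/ k = 2 * m + 1.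
    by exists (k %/ 2)%Z; lia.
  (* With the negative sign, k = 2 u lies in [0, 1] because u <= 1/2, and [k] is even. *)
  - have k0 : k = 0.
      move: uk; case: b {gx} => /=; rewrite ?expr1 ?expr0 => uk.
        have : k%:~R <= 1 :> R by lra.
        have : 0 <= k%:~R :> R by lra.
        by rewrite ler0z lerz1; lia.
      have /eqP : k%:~R = 0 :> R by lra.
      by rewrite intr_eq0 => /eqP.
    (* Now [h] fixes [y], so it is the identity, and [g] is the identity or the reflection in u = 0;
       the latter keeps a point in the half-space only on the wall, where it is trivial. *)
    move: yk; rewrite k0 scale0r addr0 => /(bb_free hGamma hG) hid.
    have [v [z xE]] := cylP x; move: gx xH x'H.
    rewrite xE hid k0 collar_act affine_act_id scale0r !addr0 => <-.
    rewrite /half_space /= !cyl_head.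
    case: b uk => /=; rewrite ?expr1 ?expr0 ?mul1r // => _ v0.
    by rewrite mulN1r oppr_ge0 => v1; congr cyl; lra.
  - by case: (odd_shift_free (k := m) (g := h) (y := y) hG); rewrite -km.
have chartHW : is_collar_chart (@half_space R n `&` W).
  by split; [exists W|move=> x [_ []]|].
exists (exist _ _ chartHW) => /=; split.
  by rewrite /half_space /= cyl_head.
split; first exact: ballxx.
by rewrite /= cyl_head; lra.
Qed.

Lemma collar_chart_transition (i j : collar_chart) x x' :
  sval i x -> sval j x' -> pi x = pi x' ->
  exists g, [/\ collar_group g, affine_act g x = x' &
    exists2 W, open_nbhs x W &
      forall z, W z -> sval i z -> sval j (affine_act g z)].
Proof.
case: i j => [U Uchart] [V Vchart] /=.
have [[W0 oW0 UE] U1 Uinj] := Uchart; have [[W oW VE] V1 Vinj] := Vchart.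
rewrite {Uchart Vchart}UE {}VE in U1 Uinj V1 Vinj *.
move=> xU x'V /(orbit_projP cgrp) [g gG gx].
(* Away from the wall, continuity keeps the images of nearby points at positive height, so [g]
   itself works. *)
have [x'0|x'pos] := eqVneq (x' 0 ord0) 0; last first.
  exists g; split=> //.
  exists (affine_act g @^-1` (W `&` [set z | 0 < z 0 ord0])).
    split; last first.
      rewrite /= gx; case: x'V => x'H ?; split=> //.
      by rewrite lt_neqAle eq_sym x'pos.
    apply: open_comp; first by move=> ? _; exact: affine_act_continuous.
    apply: openI => //.
    by apply: open_comp (@open_gt R 0) => z _; exact: head_continuous.
  by move=> z [Wz /ltW z0] _; split.
have [u [y xE]] := cylP x; have [u' [y' x'E]] := cylP x'.
move: gG gx => [b [k [h [hG ->]]]].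
rewrite xE collar_act x'E => /cyl_inj [uk yk].
have u'0 : u' = 0 by rewrite -x'0 x'E cyl_head.
have u0 : u = 0.
  have xu := collar_proj_boundary (u := u) (y := y) (y' := y').
  apply: xu; first by move: xU => [+ _]; rewrite xE /half_space /= cyl_head.
    by have := U1 _ xU; rewrite /= xE cyl_head.
  by rewrite -u'0; apply/collar_orbitP; exists b, k, h.
have k0 : k = 0.
  by move/eqP: uk; rewrite u0 u'0 mulr0 add0r intr_eq0 => /eqP.
move: yk; rewrite k0 scale0r addr0 => yk.
have gE z : affine_act (collar_map false 0 h) z =
    cyl (z 0 ord0) (affine_act h (col' ord0 z)).
  by rewrite -{1}(cylK z) collar_act /= expr0 mul1r addr0 scale0r addr0.
(* On the wall [g] may carry the sign -1 and leave the half-space; changing the sign to + does not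
   alter its action on the wall. *)
exists (collar_map false 0 h); split; first by exists false, 0, h.
  by rewrite gE cyl_head cyl_tail u0 u'0 yk.
exists (affine_act (collar_map false 0 h) @^-1` W).
  split.
    by apply: open_comp => // ? _; exact: affine_act_continuous.
  rewrite /= gE cyl_head cyl_tail yk u0 -u'0 -x'E.
  by case: x'V.
move=> z Wz [zH _]; split=> //.
by move: zH; rewrite /half_space /= gE cyl_head.
Qed.

(** * The quotient as a Riemannian manifold with boundary *)

Definition collar_manifold : riemannian_data R n.+1 :=
  @RiemannianData R n.+1 (orbit_space collar_group) collar_chart
    (fun U => pi @` sval U)
    (fun U q => xget 0 (sval U `&` pi @^-1` [set q]))
    (fun _ _ => 1%:M).

Local Notation M := collar_manifold.

Lemma collar_coordK (i : chart M) x : sval i x -> Defs.coord i (pi x) = x.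
Proof. by case: i => U [? ? Uinj] Ux; exact: xget_orbit_proj. Qed.

Lemma collar_coord_inj (i : chart M) : set_inj (dom i) (Defs.coord i).
Proof.
move=> p q /set_mem [x xi <-] /set_mem [y yi <-].
by rewrite !collar_coordK // => ->.
Qed.

Lemma collar_coord_image (i : chart M) (V : set M) :
  Defs.coord i @` (dom i `&` V) = sval i `&` pi @^-1` V.
Proof.
rewrite eqEsubset; split=> [_ [_ [[x xi <-] Vx] <-]|x [xi Vx]].
  by rewrite collar_coordK.
by exists (pi x); [split=> //; exists x|exact: collar_coordK].
Qed.

(** The half-space is not open, but the reflection [r] in u = 0 belongs to the group, so points at
    negative height can be folded back without changing their projection. *)
Lemma open_collar_proj W : open W -> open (pi @` (@half_space R n `&` W)).
Proof.
move=> oW; rewrite openE => _ [x [xH xW] <-]; rewrite /interior.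
pose r := affine_act (collar_map true 0 (affine_id R n)).
have rE u y : r (cyl u y) = cyl (- u) y.
  by rewrite /r collar_act affine_act_id scale0r !addr0 /= expr1 mulN1r.
have piE z : pi (r z) = pi z.
  apply/esym/(orbit_projP cgrp).
  exists (collar_map true 0 (affine_id R n)) => //.
  by exists true, 0, (affine_id R n); split=> //; exact: (ig_id hgrp).
have foldW (V : set 'rV[R]_n.+1) : open_nbhs x V ->
    (forall z, V z -> W z /\ (z 0 ord0 < 0 -> W (r z))) ->
    nbhs (pi x) (pi @` (@half_space R n `&` W)).
  move=> xV VW; apply: (@filterS _ _ _ (pi @` V)); last first.
    by apply: (nbhs_orbit_proj cgrp); exact: open_nbhs_nbhs.
  move=> _ [z Vz <-]; have [Wz Wr] := VW z Vz.
  have [z0|z0] := ltP (z 0 ord0) 0; last by exists z.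
  exists (r z) => //; split; last exact: Wr.
  have [u [y zE]] := cylP z; move: z0; rewrite zE rE /half_space /= !cyl_head.
  by move=> /ltW; rewrite oppr_ge0.
have [x0|xn0] := eqVneq (x 0 ord0) 0.
  apply: (foldW (W `&` r @^-1` W)) => [|z []//].
  split.
    apply: openI => //; apply: open_comp => // ? _.
    exact: affine_act_continuous.
  split=> //; have [u [y xE]] := cylP x.
  have u0 : u = 0 by rewrite -x0 xE cyl_head.
  by move: xW; rewrite /= xE rE u0 oppr0.
apply: (foldW (W `&` [set z | 0 < z 0 ord0])) => [|z [Wz z0]]; last first.
  by split=> //= zn; have := lt_trans z0 zn; rewrite ltxx.
split; last by split=> //=; rewrite lt_neqAle eq_sym xn0.
apply: openI => //.
by apply: open_comp (@open_gt R 0) => z _; exact: head_continuous.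
Qed.

Lemma collar_dom_open (i : chart M) : open (dom i).
Proof.
by case: i => U [[W oW UE] U1 Uinj]; rewrite /= UE; exact: open_collar_proj.
Qed.

Lemma collar_coord_homeo (i : chart M) (V : set M) : V `<=` dom i ->
  open V <-> exists2 W, open W & Defs.coord i @` V = @half_space R n `&` W.
Proof.
move=> Vi; rewrite -(setIidr Vi) collar_coord_image (setIidr Vi).
have [W oW iE] : exists2 W, open W & sval i = @half_space R n `&` W.
  by case: i {Vi} => U [[W oW UE] ? ?]; exists W.
split=> [oV|[W' oW' W'E]].
  exists (W `&` pi @^-1` V); last by rewrite iE setIA.
  by apply: openI => //; exact: oV.
rewrite (_ : V = pi @` (@half_space R n `&` W')); first exact: open_collar_proj.
rewrite -W'E eqEsubset; split=> [p Vp|_ [x [_ Vx] <-] //].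
by have [x xi xp] := Vi p Vp; exists x => //; split=> //=; rewrite xp.
Qed.

(** Positive increments never leave the half-space, not even transversally at the wall. *)
Lemma half_space_axis_dense W : open W -> axis_dense (@half_space R n `&` W).
Proof.
move=> oW x i e [xH xW] e0.
have [d d0 dW] := open_axis_ball (conj oW xW).
have m0 : 0 < Num.min d e by rewrite lt_min d0.
have md : `|Num.min d e / 2| < Num.min d e.
  by rewrite gtr0_norm ?divr_gt0 // ltr_pdivrMr // ltr_pMr // ltr1n.
exists (Num.min d e / 2); split; first by rewrite gt_eqF // divr_gt0.
  by rewrite (lt_le_trans md) // ge_min lexx orbT.
split; last by apply: dW; rewrite (lt_le_trans md) // ge_min lexx.
rewrite /half_space /= !mxE addr_ge0 // mulr_ge0 //.
by rewrite divr_ge0 // ltW.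
Qed.

Lemma collar_axis_dense (i : chart M) (V : set M) : open V ->
  axis_dense (Defs.coord i @` (dom i `&` V)).
Proof.
move=> oV; have Vi : dom i `&` V `<=` dom i by move=> p [].
have oiV : open (dom i `&` V) by apply: openI => //; exact: collar_dom_open.
have [W oW ->] := (collar_coord_homeo Vi).1 oiV.
exact: half_space_axis_dense.
Qed.

Lemma collar_chart_affine (i j : chart M) p : dom i p -> dom j p ->
  exists A b, A *m A^T = 1%:M /\ chart_affine (idfun : M -> M) i j p A b.
Proof.
move=> [x xi xp] [x' x'j x'p]; subst p.
have [g [gG gx [W xW Wj]]] := collar_chart_transition xi x'j (esym x'p).
exists g.1, g.2; split; first exact: (ig_isometry cgrp gG).
exists W; first by rewrite collar_coordK.
move=> _ [z zi <-] _; rewrite collar_coordK // => Wz.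
rewrite -/(affine_act g z) -(collar_coordK (Wj z Wz zi)); congr Defs.coord.
by apply/(orbit_projP cgrp); exists g.
Qed.

Lemma collar_is_riemannian : is_riemannian_manifold (@half_space R n) M.
Proof.
have idc : continuous (idfun : M -> M) by move=> ?; exact: cvg_id.
split.
- exact: (orbit_space_hausdorff cgrp collar_discrete).
- exact: (orbit_space_second_countable cgrp).
- move=> p; have [x <-] := orbit_proj_surj p; have [u [y ->]] := cylP x.
  (* Charts exist at heights in [0, 1/2]: the fractional part f of [u] is used if it is at most 1/2,
     and otherwise its reflection 1 - f. *)
  pose k := Num.floor u.
  have idG := ig_id hgrp.
  have [uk|uk] := leP (u - k%:~R) 2^-1.
    have [|i iu] := @collar_chart_at (u - k%:~R) (y - k%:~R *: t) _ uk.
      by have := floor_le u; lra.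
    exists i; exists (cyl (u - k%:~R) (y - k%:~R *: t)) => //.
    apply/collar_orbitP; exists false, k, (affine_id R n); split=> //.
      by rewrite /= expr0 mul1r subrK.
    by rewrite affine_act_id subrK.
  have [||i iu] := @collar_chart_at (1 - (u - k%:~R)) (y - (k + 1)%:~R *: t).
  - by have := floorD1_gt u; rewrite intrD -/k; lra.
  - by lra.
  exists i; exists (cyl (1 - (u - k%:~R)) (y - (k + 1)%:~R *: t)) => //.
  apply/collar_orbitP; exists true, (k + 1), (affine_id R n); split=> //.
    by rewrite /= expr1 intrD; lra.
  by rewrite affine_act_id subrK.
- exact: collar_dom_open.
- exact: collar_coord_inj.
- exact: collar_coord_homeo.
- apply: smooth_map_chart_affine => // [|i j p ip jp].
    exact: collar_coord_inj.
  by have [B [b [_ Bb]]] := collar_chart_affine ip jp; exists B, b.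
- by move=> i p _; rewrite trmx1.
- move=> i p _ v v0; rewrite mulmx1 mxE lt_neqAle eq_sym; apply/andP; split.
    move: v0; apply: contra; rewrite psumr_eq0 => [/allP v0|k _]; last first.
      by rewrite mxE -expr2 sqr_ge0.
    apply/eqP/rowP => k; rewrite [RHS]mxE; have := v0 k (mem_index_enum _).
    by rewrite /= [v^T _ _]mxE mulf_eq0 orbb => /eqP.
  by apply: sumr_ge0 => k _; rewrite mxE -expr2 sqr_ge0.
- move=> i; apply: (@smooth_on_cst _ _ _ _ _ 1%:M) => _ [p ip <-].
  by rewrite in_chart_coord //; exact: collar_coord_inj.
- apply: preserves_metric_chart_affine => // [|i j|i j p ip jp].
  + exact: collar_coord_inj.
  + by apply: collar_axis_dense; exact: collar_dom_open.
  + exact: collar_chart_affine.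
Qed.

(** * Flatness and the second fundamental form, from the constant metric *)

Lemma collar_dom_axis_dense (i : chart M) : axis_dense (Defs.coord i @` dom i).
Proof. by rewrite -(setIT (dom i)); apply: collar_axis_dense; exact: openT. Qed.

Lemma collar_metric_cst (i : chart M) x : (Defs.coord i @` dom i) x ->
  in_chart i (metric i) x = 1%:M.
Proof.
by move=> [p ip <-]; rewrite in_chart_coord //; exact: collar_coord_inj.
Qed.

Lemma collar_flat : flat M.
Proof.
move=> i p ip l k a b; apply: (riemann_curvature_cst (G0 := 1%:M)).
- exact: collar_dom_axis_dense.
- exact: collar_metric_cst.
- by exists p.
Qed.

Lemma collar_totally_geodesic : totally_geodesic_boundary M.
Proof.
move=> i p ip _ a b; rewrite /second_fundamental_form.
rewrite (_ : covariant_derivative i p _ _ = 0) ?mul0mx ?mxE //.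
apply/rowP => k; rewrite !mxE; apply: (christoffel_cst (G0 := 1%:M)).
- exact: collar_dom_axis_dense.
- exact: collar_metric_cst.
- by exists p.
Qed.

Lemma collar_boundaryP (p : M) :
  boundary p <-> exists y, pi (cyl 0 y) = p.
Proof.
split=> [[i [x xi <-]]|[y <-]].
  rewrite collar_coordK // => x0; exists (col' ord0 x).
  by rewrite -x0 cylK.
have [||i yi] := @collar_chart_at 0 y.
- by [].
- by rewrite invr_ge0.
by exists i; [exists (cyl 0 y)|rewrite collar_coordK // cyl_head].
Qed.

(** [boundary] asks for one chart with [p] at height 0. Any other chart containing [p] agrees, since
    it reads [p] at a height in [0, 1), which must be an integer. *)
Lemma collar_boundary_chart (i : chart M) (p : M) : boundary p -> dom i p ->
  exists2 y, sval i (cyl 0 y) & pi (cyl 0 y) = p.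
Proof.
move=> /collar_boundaryP [y' y'p] [x xi xp]; have [u [y xE]] := cylP x.
have [xH x1] : 0 <= x 0 ord0 /\ x 0 ord0 < 1.
  split; last by case: i xi => U [? U1 ?] /U1.
  by case: i xi => U [[W _ UE] ? ?] /=; rewrite UE => -[].
have u0 : u = 0.
  move: xH x1; rewrite xE cyl_head => u0 u1.
  by apply: (@collar_proj_boundary u y y'); rewrite // -xE xp y'p.
by exists y; rewrite -u0 -xE.
Qed.

(** * The isometry between the boundary and R^n/Gamma *)

Local Notation B := (boundary_manifold M).
Local Notation N := (bieberbach_manifold Gamma).
Local Notation piN := (@orbit_proj R n Gamma).

(** The lift is arbitrary: any two have the same image in R^n/Gamma by [collar_proj0], and the
    default 0 is never taken as boundary points have lifts. *)
Definition of_boundary (p : B) : N :=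
  piN (xget 0 [set y | pi (cyl 0 y) = set_val p]).

Definition to_boundary (q : N) : B :=
  let y := projT1 (cid (orbit_proj_surj q)) in
  exist _ (pi (cyl 0 y))
    (mem_set ((collar_boundaryP (pi (cyl 0 y))).2 (ex_intro _ y erefl))).

Lemma of_boundaryE (p : B) y : pi (cyl 0 y) = set_val p ->
  of_boundary p = piN y.
Proof.
move=> yp; rewrite /of_boundary; case: xgetP => [z _ /= zp|/(_ y) //].
by apply/collar_proj0; rewrite zp yp.
Qed.

Lemma to_boundaryE y : set_val (to_boundary (piN y)) = pi (cyl 0 y).
Proof.
rewrite /to_boundary set_valE /=; apply/collar_proj0.
by case: (cid _).
Qed.

Lemma boundary_set_val (p : B) : boundary (set_val p : M).
Proof. by case: p => p pB; rewrite set_valE /=; exact: set_mem. Qed.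

Lemma of_boundaryK : cancel of_boundary to_boundary.
Proof.
move=> p; have /collar_boundaryP [y yp] := boundary_set_val p.
apply: val_inj; rewrite (of_boundaryE yp).
by apply: etrans yp; exact: to_boundaryE.
Qed.

Lemma to_boundaryK : cancel to_boundary of_boundary.
Proof.
move=> q; have [y <-] := orbit_proj_surj q.
by apply: of_boundaryE; rewrite to_boundaryE.
Qed.

Lemma tail_continuous : continuous (fun x : 'rV[R]_n.+1 => col' ord0 x).
Proof.
apply: (@lipschitz_continuous _ _ _ _ 1) => // x x'; rewrite mul1r.
apply: mx_norm_le => // i j.
by apply: le_trans (coef_le_mx_norm _ i (lift ord0 j)); rewrite !mxE.
Qed.

Lemma cyl0_continuous : continuous (fun y : 'rV[R]_n => cyl 0 y).
Proof.
apply: (@lipschitz_continuous _ _ _ _ 1) => // y y'; rewrite mul1r.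
by rewrite cylB subrr; apply: norm_cyl_le => //; rewrite normr0.
Qed.

Lemma of_boundary_continuous : continuous of_boundary.
Proof.
apply/continuousP => V oV.
(* The subspace topology requires an open set of the whole quotient. In the strip -1 < u < 1 the
   only integer is 0, so boundary points have lifts there only on the slice u = 0. *)
pose W := [set x : 'rV[R]_n.+1 | -1 < x 0 ord0] `&` [set x | x 0 ord0 < 1] `&`
  (fun x => col' ord0 x) @^-1` (piN @^-1` V).
have oW : open W.
  apply: openI; last first.
    by apply: open_comp => // x _; exact: tail_continuous.
  apply: openI.
    by apply: open_comp (@open_gt R (-1)) => x _; exact: head_continuous.
  by apply: open_comp (@open_lt R 1) => x _; exact: head_continuous.
exists (pi @` W); first exact: (open_orbit_proj cgrp).
rewrite eqEsubset; split=> p /=.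
  have /collar_boundaryP [y yp] := boundary_set_val p.
  rewrite (of_boundaryE yp) -yp => -[x [[x1 x2] xV]].
  have [u [z xE]] := cylP x; move: x1 x2 xV; rewrite xE /= cyl_head cyl_tail.
  move=> u1 u2 zV uz.
  have u0 : u = 0.
    move/esym: uz => /collar_orbitP [b [k [h [_ uk _]]]].
    move: uk u1 u2; rewrite mulr0 add0r => ->.
    rewrite ltrz1 -(intrN R 1) ltr_int => k1 k2.
    by have -> : k = 0 by lia.
  by move: uz; rewrite u0 => /collar_proj0 <-.
have /collar_boundaryP [y yp] := boundary_set_val p.
rewrite (of_boundaryE yp) => yV; exists (cyl 0 y) => //.
by split; [split|]; rewrite /= ?cyl_head ?cyl_tail // oppr_lt0.
Qed.

Lemma to_boundary_continuous : continuous to_boundary.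
Proof.
apply/continuousP => _ [V oV <-].
suff -> : to_boundary @^-1` (set_val @^-1` V) =
    piN @` ((fun y => cyl 0 y) @^-1` (pi @^-1` V)).
  apply: (open_orbit_proj hgrp); apply: open_comp; last exact: oV.
  by move=> y _; exact: cyl0_continuous.
rewrite eqEsubset; split=> q.
  have [y <-] := orbit_proj_surj q; rewrite /= to_boundaryE => Vy.
  by exists y.
by move=> [y Vy <-]; rewrite /= to_boundaryE.
Qed.

Lemma boundary_coordE (i : chart B) (p : B) y : sval i (cyl 0 y) ->
  pi (cyl 0 y) = set_val p -> Defs.coord i p = y.
Proof.
move=> yi yp; have := congr1 (col' ord0) (collar_coordK yi).
by rewrite cyl_tail yp.
Qed.

Lemma boundary_coord_inj (i : chart B) : set_inj (dom i) (Defs.coord i).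
Proof.
move=> p q /set_mem ip /set_mem iq.
have [y yi yp] := collar_boundary_chart (boundary_set_val p) ip.
have [z zi zq] := collar_boundary_chart (boundary_set_val q) iq.
rewrite (boundary_coordE yi yp) (boundary_coordE zi zq) => yz.
by apply: val_inj; move: yp zq; rewrite yz !set_valE => -> ->.
Qed.

Lemma bieberbach_coordK (j : chart N) y :
  sval j y -> Defs.coord j (piN y) = y.
Proof. by case: j => U [oU Uinj] Uy; exact: xget_orbit_proj. Qed.

Lemma bieberbach_coord_inj (j : chart N) : set_inj (dom j) (Defs.coord j).
Proof.
move=> p q /set_mem [x xj <-] /set_mem [y yj <-].
by rewrite !bieberbach_coordK // => ->.
Qed.

(** The two charts read [p] as lifts in one orbit of [Gamma]; the element relating them also relates
    the readings of nearby points, as the chart [j] contains only one lift of each. *)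
Lemma of_boundary_chart_affine (i : chart B) (j : chart N) p :
  dom i p -> dom j (of_boundary p) ->
  exists D b, D *m D^T = 1%:M /\ chart_affine of_boundary i j p D b.
Proof.
move=> ip; have [y yi yp] := collar_boundary_chart (boundary_set_val p) ip.
rewrite (of_boundaryE yp) => -[y' y'j /esym/(orbit_projP hgrp) [h hG hy]].
exists h.1, h.2; split; first exact: (ig_isometry hgrp hG).
exists (affine_act h @^-1` sval j).
  rewrite (boundary_coordE yi yp); split; last by rewrite /= hy.
  apply: open_comp; first by move=> ? _; exact: affine_act_continuous.
  by case: j {y'j} => U [].
move=> q iq _; have [z zi zq] := collar_boundary_chart (boundary_set_val q) iq.
rewrite (boundary_coordE zi zq) (of_boundaryE zq) => zW.
rewrite -/(affine_act h z) -(bieberbach_coordK zW); congr Defs.coord.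
by apply/(orbit_projP hgrp); exists h.
Qed.

Lemma to_boundary_chart_affine (j : chart N) (i : chart B) q :
  dom j q -> dom i (to_boundary q) ->
  exists D b, chart_affine to_boundary j i q D b.
Proof.
move=> [y yj <-] /(collar_boundary_chart (boundary_set_val _)) [y' y'i].
rewrite to_boundaryE => /collar_proj0 /esym/(orbit_projP hgrp) [h hG hy].
have [W oW iE] : exists2 W, open W & sval i = @half_space R n `&` W.
  by case: i {y'i} => U [[W oW UE] ? ?]; exists W.
exists h.1, h.2; exists ((fun z => cyl 0 (affine_act h z)) @^-1` W).
  rewrite bieberbach_coordK //; split.
    apply: open_comp => // z _; apply: continuous_comp.
      exact: affine_act_continuous.
    exact: cyl0_continuous.
  by rewrite /= hy; move: y'i; rewrite iE => -[].
move=> _ [z zj <-] _; rewrite bieberbach_coordK // => Wz.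
apply: boundary_coordE.
  by rewrite iE; split=> //; rewrite /half_space /= cyl_head.
by rewrite to_boundaryE; apply/collar_proj0/esym/(orbit_projP hgrp); exists h.
Qed.

(** In boundary coordinates the domain is open in R^n: it is cut out by the slice u = 0 of an open
    set and the preimage of [dom j]. *)
Lemma boundary_axis_dense (i : chart B) (j : chart N) :
  axis_dense (Defs.coord i @` (dom i `&` of_boundary @^-1` dom j)).
Proof.
apply: open_axis_dense.
have [W oW iE] : exists2 W, open W & sval i = @half_space R n `&` W.
  by case: i => U [[W oW UE] ? ?]; exists W.
rewrite (_ : _ @` _ = (fun y => cyl 0 y) @^-1` W `&` piN @^-1` dom j).
  apply: openI; first by apply: open_comp => // y _; exact: cyl0_continuous.
  suff : open (dom j) by [].
  by apply: (open_orbit_proj hgrp); case: j => U [].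
rewrite eqEsubset; split=> [_ [p [ip jp] <-]|y [Wy jy]].
  have [y yi yp] := collar_boundary_chart (boundary_set_val p) ip.
  rewrite (boundary_coordE yi yp); split; first by move: yi; rewrite iE => -[].
  by move: jp; rewrite /= (of_boundaryE yp).
have yi : sval i (cyl 0 y).
  by rewrite iE; split=> //; rewrite /half_space /= cyl_head.
exists (to_boundary (piN y)).
  split; last by rewrite /= to_boundaryK.
  by rewrite /= to_boundaryE; exists (cyl 0 y).
by apply: boundary_coordE => //; rewrite to_boundaryE.
Qed.

Lemma boundary_isometric : isometric B N.
Proof.
exists of_boundary, to_boundary; split.
- exact: of_boundaryK.
- exact: to_boundaryK.
- apply: smooth_map_chart_affine => [||i j p ip jp].
  + exact: boundary_coord_inj.
  + exact: of_boundary_continuous.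
  + have [D [b [_ Db]]] := of_boundary_chart_affine ip jp.
    by exists D, b.
- apply: smooth_map_chart_affine => [||j i q jq iq].
  + exact: bieberbach_coord_inj.
  + exact: to_boundary_continuous.
  + exact: to_boundary_chart_affine.
- apply: preserves_metric_chart_affine => // [|i p _|i j|i j p ip jp].
  + exact: boundary_coord_inj.
  (* The induced metric is a principal submatrix of the identity. *)
  + by apply/matrixP => a b; rewrite !mxE (inj_eq lift_inj).
  + exact: boundary_axis_dense.
  + exact: of_boundary_chart_affine.
Qed.

Lemma geodesic_boundary_bieberbach : geodesic_boundary N.
Proof.
exists M; split.
- exact: collar_is_riemannian.
- exact: orbit_space_connected.
- exact: collar_compact.
- exact: collar_flat.
- by split; [exact: collar_totally_geodesic|exact: boundary_isometric].
Qed.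

End CollarGroup.

Theorem theorem4p3 (R : realType) (n : nat) (Gamma : set (affine_map R n))
    (hGamma : is_bieberbach Gamma) (hol : holonomy_isog_Z2 Gamma) :
  geodesic_boundary (bieberbach_manifold Gamma).
Proof.
have [A [t [linA A1 tA t2 tN]]] := exists_half_translation hGamma hol.
exact: (geodesic_boundary_bieberbach hGamma linA A1 tA t2 tN).
Qed.
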